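(* Let $V$ be a finite dimensional real vector space and let $A \leq \mathrm{Aff}(V)$ be a Zariski-closed subgroup acting transitively on $V$. Let $\Lambda$ be a virtually nilpotent group which is isomorphic to an affine crystallographic group of type $A$, and let $\Delta$ be a finite effective extension of $\Lambda$. Then $\Delta$ is isomorphic to an affine crystallographic group of type $A$ if and only if the kernel $\beta:\Delta/\Lambda \to \mathrm{Out}(\Lambda)$ associated to the extension has a fixed point in the deformation space $\mathcal{D}_c(\Lambda,A)$ (i.e. there is a point of $\mathcal{D}_c(\Lambda,A)$ fixed by the subgroup $\beta(\Delta/\Lambda) \leq \mathrm{Out}(\Lambda)$).
   Context: A subgroup $\Gamma$ of $\mathrm{Aff}(V) = V\rtimes \mathrm{GL}(V)$ is an affine crystallographic group if it acts properly discontinuously on $V$ with compact quotient; it is of type $A$ if $\Gamma \leq A$. $\mathrm{Hom}_c(\Lambda,A)$ is the set of injective homomorphisms $\rho: \Lambda \to A$ such that $\rho(\Lambda)$ is an affine crystallographic group, and $\mathcal{D}_c(\Lambda,A) = \mathrm{Hom}_c(\Lambda,A)/A$ is the quotient by the conjugation action of $A$. $\mathrm{Aut}(\Lambda)$ acts on $\mathrm{Hom}_c(\Lambda,A)$ by $\rho \mapsto \rho\circ\phi^{-1}$, and this induces an action of $\mathrm{Out}(\Lambda) = \mathrm{Aut}(\Lambda)/\mathrm{Inn}(\Lambda)$ on $\mathcal{D}_c(\Lambda,A)$. A finite effective extension of $\Lambda$ is a group $\Delta$ containing $\Lambda$ as a normal subgroup of finite index such that the homomorphism $\beta: \Delta/\Lambda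 \to \mathrm{Out}(\Lambda)$ induced by conjugation (the associated kernel) is injective. *)

(* Defs.v *)
From HB Require Import structures.
From mathcomp Require Import all_boot all_order all_algebra.
From mathcomp Require Import all_classical all_reals topology normedtype.
From mathcomp Require mpoly.

Set Implicit Arguments.
Unset Strict Implicit.
Unset Printing Implicit Defensive.

Import GRing.Theory numFieldNormedType.Exports.

Local Open Scope classical_set_scope.
Local Open Scope quotient_scope.
Local Open Scope group_scope.

(* Subgroups of [G] are the library's [groupClosed G]. *)

Notation "{ 'ghom' G -> H }" := (UMagmaMorphism.type G%type H%type)
  (at level 0, G at level 98, H at level 99, format "{ 'ghom'  G  ->  H }")
  : type_scope.

Section MorphismImage.
Variables (G H : groupType) (f : {ghom G -> H}).

Definition morph_img : {pred H} := [pred y | `[< exists x, f x = y >]].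

Lemma morph_imgP y : reflect (exists x, f x = y) (y \in morph_img).
Proof. exact: asboolP. Qed.

Lemma morph_img_group_closed : group_closed morph_img.
Proof.
split; first by apply/morph_imgP; exists 1; rewrite gmulf1.
move=> _ _ /morph_imgP[x <-] /morph_imgP[y <-].
by apply/morph_imgP; exists (x / y); rewrite gmulfF.
Qed.

HB.instance Definition _ :=
  isMulClosed.Build H morph_img (group_closedM morph_img_group_closed).
HB.instance Definition _ :=
  isMul1Closed.Build H morph_img (proj1 morph_img_group_closed).
HB.instance Definition _ :=
  isInvClosed.Build H morph_img (group_closedV morph_img_group_closed).

End MorphismImage.

Definition group_isom (G H : groupType) (K : groupClosed H) : Prop :=
  exists f : {ghom G -> H}, set_bij [set: G] [set` K] f.

Definition finite_index (G : groupType) (N : groupClosed G) : Prop :=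
  finite_set [set [set x * y | y in [set` N]] | x in [set: G]].

Definition gen_subgroup (G : groupType) (S : set G) : set G :=
  [set x | forall K : groupClosed G, S `<=` [set` K] -> x \in K].

Fixpoint lower_central (G : groupType) (N : groupClosed G) (n : nat) : set G :=
  if n is m.+1 then
    gen_subgroup
      [set [~ x, y] | x in lower_central N m & y in [set` N]]
  else [set` N].

Definition nilpotent_subgroup (G : groupType) (N : groupClosed G) : Prop :=
  exists n, lower_central N n = [set 1].

Definition virtually_nilpotent (G : groupType) : Prop :=
  exists N : groupClosed G, finite_index N /\ nilpotent_subgroup N.

Record normalGroup (G : groupType) := NormalGroup {
  normal_carrier :> groupClosed G;
  normalJ : forall x y, x \in normal_carrier -> x ^ y \in normal_carrier }.

Section QuotientGroup.
Variables (G : groupType) (N : normalGroup G).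

Definition coset_rel : rel G := fun x y => x^-1 * y \in N.

Lemma coset_rel_refl : reflexive coset_rel.
Proof. by move=> x; rewrite /coset_rel mulVg gpred1. Qed.

Lemma coset_rel_sym : symmetric coset_rel.
Proof. by move=> x y; rewrite /coset_rel -gpredV invgM invgK. Qed.

Lemma coset_rel_trans : transitive coset_rel.
Proof.
move=> y x z xy yz; rewrite /coset_rel.
by have := gpredM _ _ xy yz; rewrite mulgA mulgK.
Qed.

Canonical coset_equiv :=
  EquivRel coset_rel coset_rel_refl coset_rel_sym coset_rel_trans.

Definition quotient_group := {eq_quot coset_rel}.
HB.instance Definition _ := Choice.on quotient_group.
HB.instance Definition _ := EqQuotient.on quotient_group.

Definition qmul (a b : quotient_group) : quotient_group :=
  \pi_quotient_group (repr a * repr b).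
Definition qinv (a : quotient_group) : quotient_group := \pi_quotient_group (repr a)^-1.

Lemma coset_eqP x y :
  reflect (\pi_quotient_group x = \pi_quotient_group y) (x^-1 * y \in N).
Proof. exact: (@eqquotP G coset_rel quotient_group x y). Qed.

Lemma repr_coset x : (repr (\pi_quotient_group x))^-1 * x \in N.
Proof. by apply/coset_eqP; rewrite reprK. Qed.

Lemma pi_mul x y :
  \pi_quotient_group (x * y) = qmul (\pi_quotient_group x) (\pi_quotient_group y).
Proof.
apply/esym/coset_eqP; set u := repr _; set v := repr _.
have -> : (u * v)^-1 * (x * y) = (u^-1 * x) ^ v * (v^-1 * y).
  by rewrite invgM conjgE !mulgA mulgK.
by apply: gpredM; [apply: normalJ|]; apply: repr_coset.
Qed.

Lemma pi_inv x : \pi_quotient_group x^-1 = qinv (\pi_quotient_group x).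
Proof.
apply/esym/coset_eqP; set u := repr _; rewrite invgK.
have -> : u * x^-1 = (x^-1 * u) ^ x^-1 by rewrite conjgE invgK mulgA mulVKg.
apply: normalJ; rewrite -gpredV invgM invgK; exact: repr_coset.
Qed.

Lemma qmulA : associative qmul.
Proof.
elim/quotW=> x; elim/quotW=> y; elim/quotW=> z.
by rewrite -(pi_mul y z) -(pi_mul x y) -(pi_mul x) -(pi_mul _ z) mulgA.
Qed.
Lemma qmul1 : left_id (\pi_quotient_group 1) qmul.
Proof. by elim/quotW=> x; rewrite -pi_mul mul1g. Qed.
Lemma qmulr1 : right_id (\pi_quotient_group 1) qmul.
Proof. by elim/quotW=> x; rewrite -pi_mul mulg1. Qed.
Lemma qmulV : left_inverse (\pi_quotient_group 1) qinv qmul.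
Proof. by elim/quotW=> x; rewrite -pi_inv -pi_mul mulVg. Qed.
Lemma qmulrV : right_inverse (\pi_quotient_group 1) qinv qmul.
Proof. by elim/quotW=> x; rewrite -pi_inv -pi_mul mulgV. Qed.

HB.instance Definition _ :=
  isGroup.Build quotient_group qmulA qmul1 qmulr1 qmulV qmulrV.

End QuotientGroup.

Record aut (G : groupType) := Aut {
  aut_fun :> G -> G;
  aut_inv : G -> G;
  autM : {morph aut_fun : x y / x * y};
  aut_funK : cancel aut_fun aut_inv;
  aut_invK : cancel aut_inv aut_fun }.

Section AutGroup.
Variable G : groupType.
Implicit Types a b c : aut G.

HB.instance Definition _ := gen_eqMixin (aut G).
HB.instance Definition _ := gen_choiceMixin (aut G).

Lemma autP a b : a =1 b -> a = b.
Proof.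
case: a b => [f f' fM fK f'K] [g g' gM gK g'K] /= /funext fg.
move: gM gK g'K; rewrite -{}fg => gM gK g'K.
have fg' : f' = g' by apply/funext => x; rewrite -[in LHS](g'K x) fK.
move: gK g'K; rewrite -{}fg' => gK g'K.
by congr Aut; apply: Prop_irrelevance.
Qed.

Lemma aut_invM a : {morph aut_inv a : x y / x * y}.
Proof.
by move=> x y; rewrite -[in LHS](aut_invK a x) -[in LHS](aut_invK a y) -autM
  aut_funK.
Qed.

Definition aut_id : aut G :=
  @Aut G id id (fun _ _ => erefl) (fun _ => erefl) (fun _ => erefl).

Lemma aut_compM a b : {morph a \o b : x y / x * y}.
Proof. by move=> x y /=; rewrite !autM. Qed.

Definition aut_comp a b : aut G :=
  Aut (aut_compM a b) (can_comp (aut_funK a) (aut_funK b))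
    (can_comp (aut_invK b) (aut_invK a)).

Definition aut_opp a : aut G := Aut (aut_invM a) (aut_invK a) (aut_funK a).

Lemma aut_compA : associative aut_comp.
Proof. by move=> a b c; apply: autP. Qed.
Lemma aut_comp1 : left_id aut_id aut_comp.
Proof. by move=> a; apply: autP. Qed.
Lemma aut_compr1 : right_id aut_id aut_comp.
Proof. by move=> a; apply: autP. Qed.
Lemma aut_compV : left_inverse aut_id aut_opp aut_comp.
Proof. by move=> a; apply: autP => x /=; rewrite aut_funK. Qed.
Lemma aut_comprV : right_inverse aut_id aut_opp aut_comp.
Proof. by move=> a; apply: autP => x /=; rewrite aut_invK. Qed.

HB.instance Definition _ :=
  isGroup.Build (aut G) aut_compA aut_comp1 aut_compr1 aut_compV aut_comprV.

(* [x ^ g^-1] is [g * x * g^-1], so that [inn] is a morphism for composition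
   of automorphisms. *)
Definition inn (g : G) : aut G :=
  @Aut G (fun x => x ^ g^-1) (fun x => x ^ g)
    (fun x y => conjMg x y g^-1) (conjgKV g) (conjgK g).

Lemma inn_mul : {morph inn : g h / g * h}.
Proof. by move=> g h; apply: autP => x /=; rewrite invgM conjgM. Qed.

Lemma inn1 : inn 1 = 1.
Proof. by apply: autP => x /=; rewrite invg1 conjg1. Qed.

HB.instance Definition _ :=
  isUMagmaMorphism.Build G (aut G) inn (conj inn1 inn_mul).

Lemma inn_normal (a b : aut G) :
  a \in morph_img inn -> a ^ b \in morph_img inn.
Proof.
move=> /morph_imgP[g <-]; apply/morph_imgP; exists (aut_inv b g).
apply: autP => x.
have -> : (inn g ^ b) x = aut_inv b (inn g (b x)) by [].
rewrite /= !conjgE !invgK !aut_invM aut_funK; congr (_ * (_ * _)).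
apply: (mulgI (aut_inv b g)); rewrite -aut_invM !mulgV.
by apply: (mulgI (aut_inv b 1)); rewrite mulg1 -aut_invM mulg1.
Qed.

Definition Inn : normalGroup (aut G) := NormalGroup inn_normal.

Definition Out : groupType := quotient_group Inn.

End AutGroup.

Lemma aut_fun1 (G : groupType) (a : aut G) : a 1 = 1.
Proof. by apply: (mulgI (a 1)); rewrite -autM !mulg1. Qed.

HB.instance Definition _ (G : groupType) (a : aut G) :=
  isUMagmaMorphism.Build G G (aut_fun a) (conj (aut_fun1 a) (@autM G a)).

(* [Delta] contains the image of [Lambda] under an embedding as a normal
   subgroup. *)
Record extension (Lambda Delta : groupType) := Extension {
  ext_emb :> {ghom Lambda -> Delta};
  ext_inj : injective ext_emb;
  ext_imgJ : forall x y,
    x \in morph_img ext_emb -> x ^ y \in morph_img ext_emb }.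

Section Extension.
Variables (Lambda Delta : groupType) (E : extension Lambda Delta).
Implicit Types (x y : Lambda) (d : Delta).

Definition ext_normal : normalGroup Delta := NormalGroup (@ext_imgJ _ _ E).

Definition ext_quotient : groupType := quotient_group ext_normal.

Lemma ext_conj_subproof d x : exists y, E y = E x ^ d.
Proof. by apply/morph_imgP/ext_imgJ/morph_imgP; exists x. Qed.

Definition ext_conj d x : Lambda := projT1 (cid (ext_conj_subproof d x)).

Lemma ext_conjE d x : E (ext_conj d x) = E x ^ d.
Proof. by rewrite /ext_conj; case: cid. Qed.

Lemma ext_conjM d : {morph ext_conj d : x y / x * y}.
Proof.
by move=> x y; apply: (@ext_inj _ _ E); rewrite gmulfM !ext_conjE gmulfM conjMg.
Qed.

Lemma ext_conjK d : cancel (ext_conj d^-1) (ext_conj d).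
Proof. by move=> x; apply: (@ext_inj _ _ E); rewrite !ext_conjE conjgKV. Qed.

Lemma ext_conjKV d : cancel (ext_conj d) (ext_conj d^-1).
Proof. by move=> x; apply: (@ext_inj _ _ E); rewrite !ext_conjE conjgK. Qed.

Definition ext_aut d : aut Lambda :=
  Aut (@ext_conjM d^-1) (@ext_conjK d) (@ext_conjKV d).

Lemma ext_autE d x : E (ext_aut d x) = d * E x * d^-1.
Proof. by rewrite ext_conjE conjgE invgK mulgA. Qed.

Lemma ext_autM : {morph ext_aut : c d / c * d}.
Proof.
move=> c d; apply: autP => x; apply: (@ext_inj _ _ E).
by rewrite -[(ext_aut c * ext_aut d) x]/(ext_aut c (ext_aut d x)) !ext_autE invgM
  !mulgA.
Qed.

Lemma ext_aut_emb x : ext_aut (E x) = inn x.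
Proof.
by apply: autP => y; apply: (@ext_inj _ _ E); rewrite ext_conjE gmulfJ gmulfV.
Qed.

(* Conjugation of [Lambda] by [Delta]; independent of the chosen representative
   by [ext_kernel_pi]. *)
Definition ext_kernel (q : ext_quotient) : Out Lambda :=
  \pi_(Out Lambda) (ext_aut (repr q)).

Lemma ext_kernel_pi d :
  ext_kernel (\pi_ext_quotient d) = \pi_(Out Lambda) (ext_aut d).
Proof.
apply/coset_eqP; set c := repr _.
have /morph_imgP[x Ex] : c^-1 * d \in morph_img E.
  exact: (@repr_coset _ ext_normal).
have -> : d = c * E x by rewrite Ex mulVKg.
by rewrite ext_autM mulKg ext_aut_emb; apply/morph_imgP; exists x.
Qed.

Lemma ext_kernelM : {morph ext_kernel : p q / p * q}.
Proof.
elim/quotW=> c; elim/quotW=> d.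
rewrite -[_ * _]/(qmul _ _) -pi_mul !ext_kernel_pi ext_autM.
exact: pi_mul.
Qed.

HB.instance Definition _ :=
  isMultiplicative.Build ext_quotient (Out Lambda) ext_kernel ext_kernelM.

Definition finite_effective_extension : Prop :=
  finite_index (morph_img E) /\ injective ext_kernel.

End Extension.

Local Open Scope ring_scope.

Definition vcoord (R : fieldType) (V : vectType R) : V -> 'rV[R]_(\dim {:V}) :=
  passmx.rVof (vbasis {:V}).

(* An element [(v, g)] of [V * GL(V)]; endomorphisms of a finite dimensional
   space are invertible as soon as their kernel is trivial. *)
Record Aff (R : fieldType) (V : vectType R) := MkAff {
  aff_val : V * 'End(V);
  _ : lker aff_val.2 == 0%VS }.

HB.instance Definition _ (R : fieldType) (V : vectType R) :=
  [isSub for @aff_val R V].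
HB.instance Definition _ (R : fieldType) (V : vectType R) :=
  [Choice of Aff V by <:].

Section AffineGroup.
Variables (R : fieldType) (V : vectType R).
Implicit Types (g h : Aff V).

Definition aff_trans g : V := (aff_val g).1.
Definition aff_lin g : 'End(V) := (aff_val g).2.

Definition aff_act g (x : V) : V := aff_lin g x + aff_trans g.

Lemma aff_linP g : lker (aff_lin g) == 0%VS.
Proof. by case: g. Qed.

Lemma affP g h : aff_trans g = aff_trans h -> aff_lin g = aff_lin h -> g = h.
Proof.
case: g h => [[v f] fP] [[w k] kP]; rewrite /aff_trans /aff_lin /= => vw fk.
by apply: val_inj; rewrite /= vw fk.
Qed.

Lemma aff_one_subproof : lker (0 : V, \1%VF : 'End(V)).2 == 0%VS.
Proof. by apply/lker0P => x y /=; rewrite !lfunE. Qed.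

Definition aff_one : Aff V := MkAff aff_one_subproof.

Lemma aff_mul_subproof g h :
  lker (aff_act g (aff_trans h), (aff_lin g \o aff_lin h)%VF).2 == 0%VS.
Proof.
apply/lker0P => x y /=; rewrite !lfunE /=.
by move/(lker0P (aff_linP g))/(lker0P (aff_linP h)).
Qed.

Definition aff_mul g h : Aff V := MkAff (aff_mul_subproof g h).

Lemma aff_inv_subproof g :
  lker (- (aff_lin g)^-1%VF (aff_trans g), (aff_lin g)^-1%VF).2 == 0%VS.
Proof.
apply/lker0P => x y /= /(congr1 (aff_lin g)).
by rewrite !(lker0_lfunVK (aff_linP g)).
Qed.

Definition aff_inv g : Aff V := MkAff (aff_inv_subproof g).

Lemma aff_mulA : associative aff_mul.
Proof.
move=> g h k; apply: affP; rewrite /aff_mul /aff_trans /aff_lin /=.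
  by rewrite /aff_act /aff_trans /aff_lin /= !lfunE /= linearD addrA.
exact: comp_lfunA.
Qed.

Lemma aff_mul1 : left_id aff_one aff_mul.
Proof.
move=> g; apply: affP; rewrite /aff_mul /aff_trans /aff_lin /=.
  by rewrite /aff_act /aff_trans /aff_lin /= lfunE addr0.
exact: comp_lfun1l.
Qed.

Lemma aff_mulr1 : right_id aff_one aff_mul.
Proof.
move=> g; apply: affP; rewrite /aff_mul /aff_trans /aff_lin /=.
  by rewrite /aff_act /aff_trans /aff_lin /= linear0 add0r.
exact: comp_lfun1r.
Qed.

Lemma aff_mulV : left_inverse aff_one aff_inv aff_mul.
Proof.
move=> g; apply: affP; rewrite /aff_mul /aff_trans /aff_lin /=.
  by rewrite /aff_act /aff_trans /aff_lin /= subrr.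
exact: (lker0_compVf (aff_linP g)).
Qed.

Lemma aff_mulrV : right_inverse aff_one aff_inv aff_mul.
Proof.
move=> g; apply: affP; rewrite /aff_mul /aff_trans /aff_lin /=.
  rewrite /aff_act /aff_trans /aff_lin /= linearN.
  by have /= -> := lker0_lfunVK (aff_linP g) (aff_trans g); rewrite addNr.
exact: (lker0_compfV (aff_linP g)).
Qed.

HB.instance Definition _ :=
  isGroup.Build (Aff V) aff_mulA aff_mul1 aff_mulr1 aff_mulV aff_mulrV.

Lemma aff_actM g h x : aff_act (g * h)%g x = aff_act g (aff_act h x).
Proof.
rewrite {1}/aff_act /aff_lin /aff_trans /= lfunE /= /aff_act /aff_lin /aff_trans.
by rewrite linearD addrA.
Qed.

Lemma aff_act1 x : aff_act 1%g x = x.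
Proof. by rewrite /aff_act /aff_lin /aff_trans /= lfunE addr0. Qed.

Definition aff_transitive (A : groupClosed (Aff V)) : Prop :=
  forall x y, exists2 g, g \in A & aff_act g x = y.

(* The polynomials are in the coordinates of the vector space
   [V * End(V)]; every closed subset of [V * GL(V)] is cut out by such
   polynomials, as the regular functions on it are these polynomials divided
   by powers of the determinant. *)
Definition zariski_closed (A : groupClosed (Aff V)) : Prop :=
  exists S : set (mpoly.mpoly (\dim {:(V * 'End(V))%type}) R),
    [set` A] =
      [set g | forall p, S p -> mpoly.meval (vcoord (aff_val g) 0) p = 0].

End AffineGroup.

(* The usual topology of the finite dimensional real vector space [V],
   transported from row vectors by a linear coordinate system. *)
Notation vtop V := (initial_topology (@vcoord _ V)).

Section OrbitSpace.
Variables (R : realType) (V : vectType R) (Gamma : groupClosed (Aff V)).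

Definition orbit_rel : rel (vtop V) :=
  fun x y => `[< exists2 g, g \in Gamma & aff_act g x = y >].

Lemma orbit_rel_refl : reflexive orbit_rel.
Proof. by move=> x; apply/asboolP; exists 1%g; rewrite ?gpred1 ?aff_act1. Qed.

Lemma orbit_rel_sym : symmetric orbit_rel.
Proof.
suff imp x y : orbit_rel x y -> orbit_rel y x by move=> x y; apply/idP/idP => /imp.
move=> /asboolP[g gG <-]; apply/asboolP; exists g^-1%g; first by rewrite gpredV.
by rewrite -aff_actM mulVg aff_act1.
Qed.

Lemma orbit_rel_trans : transitive orbit_rel.
Proof.
move=> _ x _ /asboolP[g gG <-] /asboolP[h hG <-]; apply/asboolP.
by exists (h * g)%g; [exact: gpredM | rewrite aff_actM].
Qed.

Canonical orbit_equiv :=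
  EquivRel orbit_rel orbit_rel_refl orbit_rel_sym orbit_rel_trans.

Definition orbit_space := quotient_topology {eq_quot orbit_rel}.

Definition properly_discontinuous : Prop :=
  forall K : set (vtop V), compact K ->
    finite_set [set g | g \in Gamma /\ (aff_act g @` K) `&` K !=set0].

Definition affine_crystallographic : Prop :=
  properly_discontinuous /\ compact [set: orbit_space].

End OrbitSpace.

Definition isom_crystallographic_of_type (R : realType) (V : vectType R)
    (A : groupClosed (Aff V)) (G : groupType) : Prop :=
  exists Gamma : groupClosed (Aff V),
    [/\ affine_crystallographic Gamma, {subset Gamma <= A}
      & group_isom G Gamma].

Local Open Scope group_scope.

Record Homc (R : realType) (V : vectType R) (A : groupClosed (Aff V))
    (Lambda : groupType) := MkHomc {
  homc_fun :> {ghom Lambda -> Aff V};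
  homc_inj : injective homc_fun;
  homc_cryst : affine_crystallographic (morph_img homc_fun);
  homc_sub : {subset morph_img homc_fun <= A} }.

Lemma groupClosed_ext (G : groupType) (H K : groupClosed G) : H =i K -> H = K.
Proof.
case: H K => [S [[m1] [m2] [m3]]] [T [[n1] [n2] [n3]]] ST.
have {}ST : S = T by apply/funext => x; exact: ST.
rewrite -{}ST in n1 n2 n3 *.
by rewrite (Prop_irrelevance m1 n1) (Prop_irrelevance m2 n2)
  (Prop_irrelevance m3 n3).
Qed.

Section DeformationSpace.
Variables (R : realType) (V : vectType R) (A : groupClosed (Aff V)).
Variable Lambda : groupType.
Implicit Types (rho : Homc A Lambda) (phi : aut Lambda).

HB.instance Definition _ := gen_eqMixin (Homc A Lambda).
HB.instance Definition _ := gen_choiceMixin (Homc A Lambda).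

Definition homc_conj : rel (Homc A Lambda) := fun rho sigma =>
  `[< exists2 a, a \in A & forall x, sigma x = a * rho x * a^-1 >].

Lemma homc_conj_refl : reflexive homc_conj.
Proof.
move=> rho; apply/asboolP; exists 1; first exact: gpred1.
by move=> x; rewrite invg1 mul1g mulg1.
Qed.

Lemma homc_conj_sym : symmetric homc_conj.
Proof.
suff imp rho sigma : homc_conj rho sigma -> homc_conj sigma rho.
  by move=> rho sigma; apply/idP/idP => /imp.
move=> /asboolP[a aA E]; apply/asboolP; exists a^-1; first by rewrite gpredV.
by move=> x; rewrite E invgK !mulgA mulVg mul1g mulgVK.
Qed.

Lemma homc_conj_trans : transitive homc_conj.
Proof.
move=> sigma rho tau /asboolP[a aA Ea] /asboolP[b bA Eb]; apply/asboolP.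
exists (b * a); first exact: gpredM.
by move=> x; rewrite Eb Ea invgM !mulgA.
Qed.

Canonical homc_conj_equiv :=
  EquivRel homc_conj homc_conj_refl homc_conj_sym homc_conj_trans.

Definition Dc := {eq_quot homc_conj}.
HB.instance Definition _ := Choice.on Dc.
HB.instance Definition _ := EqQuotient.on Dc.

Definition homc_comp rho phi : {ghom Lambda -> Aff V} := rho \o phi.

Lemma homc_comp_inj rho phi : injective (homc_comp rho phi).
Proof. exact: inj_comp (@homc_inj _ _ _ _ rho) (can_inj (@aut_funK _ phi)). Qed.

Lemma homc_comp_img rho phi : morph_img (homc_comp rho phi) =i morph_img rho.
Proof.
move=> g; apply/morph_imgP/morph_imgP => -[x <-]; first by exists (phi x).
by exists (aut_inv phi x); rewrite /= aut_invK.
Qed.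

Lemma homc_comp_cryst rho phi :
  affine_crystallographic (morph_img (homc_comp rho phi)).
Proof.
have := homc_cryst rho; congr affine_crystallographic.
exact/esym/groupClosed_ext/homc_comp_img.
Qed.

Lemma homc_comp_sub rho phi : {subset morph_img (homc_comp rho phi) <= A}.
Proof. by move=> g; rewrite homc_comp_img => /homc_sub. Qed.

Definition homc_act phi rho : Homc A Lambda :=
  MkHomc (@homc_comp_inj rho phi^-1) (@homc_comp_cryst rho phi^-1)
    (@homc_comp_sub rho phi^-1).

(* Independent of the chosen representatives by [Dc_act_pi]. *)
Definition Dc_act (o : Out Lambda) (c : Dc) : Dc :=
  \pi_Dc (homc_act (repr o) (repr c)).

Lemma Dc_act_pi phi rho :
  Dc_act (\pi_(Out Lambda) phi) (\pi_Dc rho) = \pi_Dc (homc_act phi rho).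
Proof.
apply/eqquotP; set psi := repr _; set sigma := repr _.
have /morph_imgP[z phiE] : psi^-1 * phi \in morph_img (@inn Lambda).
  exact: (@repr_coset _ (Inn Lambda)).
have /eqquotP/asboolP[a aA rhoE] : \pi_Dc sigma = \pi_Dc rho by rewrite reprK.
have {}phiE : phi^-1 = inn z^-1 * psi^-1.
  by rewrite gmulfV phiE invgM invgK mulgK.
apply/asboolP; exists (a * (sigma z)^-1).
  by rewrite gpredM ?gpredV //; apply: homc_sub; apply/morph_imgP; exists z.
move=> x; rewrite -[homc_act phi rho x]/(rho (phi^-1 x)) rhoE.
have -> : phi^-1 x = z^-1 * psi^-1 x * z.
  by rewrite phiE -[LHS]/((psi^-1 x) ^ z^-1^-1) invgK conjgE mulgA.
rewrite -[homc_act psi sigma x]/(sigma (psi^-1 x)).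
by rewrite !gmulfM gmulfV invgM invgK !mulgA.
Qed.

End DeformationSpace.

(* Main.v *)
From HB Require Import structures.
Require Import Defs.
From mathcomp Require Import all_boot all_order all_algebra.
From mathcomp Require Import all_classical all_reals topology normedtype.

(** If [Delta] is realized by [f : Delta -> A], the restriction of [f] to
    [Lambda] is again crystallographic (finite index), and conjugation by the
    element [f d] of [A] undoes the action of [d] on this restriction: its class
    is a fixed point ([restriction_fixed_point]).

    Conversely let the class of [rho : Lambda -> A] be fixed. For every [d] in
    [Delta] some [a d] in [A] intertwines [rho] with its twist by [d]. The map
    [a] can be chosen compatible with [rho] on cosets of [Lambda] ([lift]), and
    then it fails to be a morphism only by a 2-cocycle [defect] of the finite
    group [Delta / Lambda] with values in the centralizer [Z] of [rho Lambda] in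
    [A]. It remains to show that this cocycle can be killed; the reason is that
    [Z] is a unipotent group with roots.

    - [Z] is unipotent. Let [z] commute with a crystallographic group [Gamma].
      The Fitting decomposition of [z - 1], acting on homogeneous coordinates,
      is preserved by [Gamma]: it splits [V] as [E * W] with [E] an affine
      subspace, [W] a linear one, and [Gamma] acting linearly on [W]. Only
      finitely many elements of [Gamma] return a compact part of [E] near
      itself, so they cannot bring the unbounded set of points above one point
      of [E] back to a compact set, unless [W = 0]
      ([centralizer_crystallographic_unipotent]).

    - The matrices [z - 1], for [z] in [Z], generate a nilpotent algebra. This is
      Kolchin's theorem: the linear span of these matrices is closed under
      product and consists of matrices of trace zero, hence of nilpotent matrices
      ([kolchin]).

    - [Z] is divisible. The powers of a unipotent [z] are polynomial in the
      exponent, so a Zariski closed group that contains all [z ^+ k] contains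
      the root [z ^ (1 / m)] as well ([closed_unipotent_root]).

    So [Z] carries a filtration whose layers embed in real vector spaces, and on
    which [m]-th roots become division by [m]. Averaging the cocycle over
    [Delta / Lambda] makes it a coboundary modulo the next layer, for all layers
    in turn ([lift_improve]), and [a] becomes a morphism ([lift_morphism]). Its
    kernel acts trivially on [Lambda], so it lies in [Lambda] by effectiveness
    of the extension, and it is trivial because [rho] is injective. *)

Set Implicit Arguments. Unset Strict Implicit. Unset Printing Implicit Defensive.
Import Order.TTheory GRing.Theory Num.Theory passmx numFieldNormedType.Exports.
Local Open Scope classical_set_scope.
Local Open Scope quotient_scope.
Local Open Scope ring_scope.

(** * Nilpotent matrices and Kolchin's theorem *)

(** The idempotent is the projection onto the Fitting summand where [a] is
    invertible. Writing [char_poly a = q * 'X^k] with [q] prime to ['X], a Bezout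
    relation between ['X^(k.+1)] and [q] yields it as a polynomial in [a] without
    constant term; hence it commutes with all that commutes with [a], and its
    trace is a combination of traces of positive powers of [a]. *)
Lemma fitting_idempotent (F : fieldType) (n : nat) (a : 'M[F]_n.+1) :
  exists p : {poly F}, let e := a * horner_mx a p in
    e * e = e /\ (e = 0 -> exists k, a ^+ k = 0).
Proof.
have [k [q]] := multiplicity_XsubC (char_poly a) 0.
rewrite polyC0 subr0 (monic_neq0 (char_poly_monic a)) /= => q0 chi.
have /Bezout_eq1_coprimepP[[u v] /= uv1] : coprimep ('X ^+ k.+1) q.
  by apply: coprimep_expl; rewrite coprimep_sym coprimepX.
exists (u * 'X^k).
have -> : a * horner_mx a (u * 'X^k) = horner_mx a (u * 'X^(k.+1)).
  by rewrite -{1}[a]horner_mx_X -rmorphM /= exprS mulrCA.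
have q_a : horner_mx a (v * q) = 1 - horner_mx a (u * 'X^(k.+1)).
  by rewrite -(rmorph1 (horner_mx a)) -uv1 rmorphD /= addrC addKr.
have chi0 : horner_mx a (q * 'X^k) = 0 by rewrite -chi Cayley_Hamilton.
split; last first.
  move=> e0; exists k; move: q_a; rewrite e0 subr0 => vq1.
  rewrite -[LHS]mul1r -vq1 -[X in _ * X ^+ _]horner_mx_X -rmorphXn -rmorphM /=.
  by rewrite -mulrA rmorphM /= chi0 mulr0.
apply/eqP; rewrite -subr_eq0 -{3}[horner_mx _ _]mulr1 -mulrBr -opprB -q_a mulrN.
rewrite oppr_eq0 -rmorphM /=.
have -> : u * 'X^(k.+1) * (v * q) = u * v * 'X * (q * 'X^k).
  by rewrite exprS mulrACA -!mulrA; do 3 congr (_ * _); rewrite mulrC.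
by rewrite rmorphM /= chi0 mulr0.
Qed.

Lemma mxtrace_idempotent (F : fieldType) (n : nat) (e : 'M[F]_n) :
  e *m e = e -> \tr e = (\rank e)%:R.
Proof.
move=> ee; have [C CK] := row_fullP (col_base_full e).
have [B BK] := row_freeP (row_base_free e).
have bc : row_base e *m col_base e = 1%:M.
  have Cc : C *m e = row_base e.
    by have := congr1 (mulmx C) (mulmx_base e); rewrite mulmxA CK mul1mx.
  have eB : e *m B = col_base e.
    by have := congr1 (mulmxr B) (mulmx_base e); rewrite /= -mulmxA BK mulmx1.
  by rewrite -Cc -eB mulmxA -(mulmxA C) ee Cc BK.
by rewrite -[X in \tr X](mulmx_base e) mxtrace_mulC bc mxtrace1.
Qed.

(** As ['X%:M - a] divides ['X%:M ^+ k], the characteristic polynomial of [a]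
    divides a power of ['X], so its subleading coefficient vanishes. *)
Lemma mxtrace_nilpotent (F : fieldType) (n k : nat) (a : 'M[F]_n.+1) :
  a ^+ k = 0 -> \tr a = 0.
Proof.
move=> ak; set b := map_mx polyC a.
have bk : b ^+ k = 0 by rewrite -rmorphXn /= ak map_mx0.
have : (char_poly a %| ('X - 0%:P) ^+ (k * n.+1)%N).
  have det_exp (A : 'M[{poly F}]_n.+1) j : \det (A ^+ j) = \det A ^+ j.
    by elim: j => [|j IH]; rewrite ?expr0 ?det1 // !exprS -IH -det_mulmx.
  rewrite polyC0 subr0 mulnC exprM -(det_scalar n.+1) -det_exp.
  have cb : GRing.comm ('X%:M : 'M[{poly F}]_n.+1) b by apply: esym (scalar_mxC _ _).
  have := subrXX_comm k cb; rewrite bk subr0 => ->.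
  by rewrite det_mulmx dvdp_mulr // dvdpp.
case/dvdp_exp_XsubCP => j _; rewrite polyC0 subr0.
rewrite eqp_monic ?char_poly_monic ?monicXn // => /eqP chi.
have := size_char_poly a; rewrite chi size_polyXn => -[jn].
apply/eqP; rewrite -oppr_eq0 -char_poly_trace // chi jn coefXn /=.
by rewrite ltn_eqF.
Qed.

(** The Fitting idempotent of [a] has trace zero, and in characteristic zero the
    trace of an idempotent determines its rank. *)
Lemma nilpotent_of_mxtrace (F : numFieldType) (n : nat) (a : 'M[F]_n.+1) :
  (forall k, \tr (a ^+ k.+1) = 0) -> exists k, a ^+ k = 0.
Proof.
move=> tr0; have [p [ee]] := fitting_idempotent a; apply.
have tr_p k : \tr (a ^+ k.+1 * horner_mx a p) = 0.
  elim/poly_ind: p k {ee} => [|p c IH] k; first by rewrite rmorph0 mulr0 mxtrace0.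
  rewrite rmorphD rmorphM /= horner_mx_X horner_mx_C mulrDr mxtraceD.
  rewrite (_ : horner_mx a p * a = a * horner_mx a p); last first.
    by apply/comm_horner_mx/comm_mx_refl.
  rewrite mulrA -exprSr IH add0r.
  by rewrite -[_ * _]/(_ *m _) mul_mx_scalar mxtraceZ tr0 mulr0.
have := mxtrace_idempotent ee; have /= -> := tr_p 0%N.
by move/esym/eqP; rewrite pnatr_eq0 mxrank_eq0 => /eqP.
Qed.

(** If a product of [n.+1] elements did not kill [w], then [w] and its images under
    the partial products would be [n.+2] vectors, hence linearly dependent. In a
    dependence relation the vector that was reached first is the image of itself
    under an element of [J], which is nilpotent. *)
Lemma nil_algebra_nilpotent (F : fieldType) (n : nat) (J : 'M[F]_n.+1 -> Prop) :
    (forall a b, J a -> J b -> J (a + b)) ->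
    (forall c a, J a -> J (c *: a)) ->
    (forall a b, J a -> J b -> J (a * b)) ->
    (forall a, J a -> exists k, a ^+ k = 0) ->
  forall s : seq 'M[F]_n.+1, size s = n.+1 -> (forall a, a \in s -> J a) ->
  \prod_(a <- s) a = 0.
Proof.
move=> JD JZ JM Jnil s sz_s Js.
pose q i := \prod_(a <- drop i s) a.
have JP (t : seq 'M[F]_n.+1) : t != [::] -> (forall a, a \in t -> J a) ->
    J (\prod_(a <- t) a).
  elim: t => // a [|b t] IH _ Jt; rewrite big_cons.
    by rewrite big_nil mulr1; apply: Jt; rewrite inE.
  apply: JM; first by apply: Jt; rewrite inE eqxx.
  by apply: IH => // x xt; apply: Jt; rewrite inE xt orbT.
suff q0 (w : 'cV_n.+1) : q 0%N *m w = 0.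
  apply/matrixP => i j; have /colP/(_ i) := q0 (delta_mx j 0).
  by rewrite -colE /q drop0 !mxE.
pose A : 'M_(n.+2, n.+1) := \matrix_(i, j) (q i *m w) j 0.
have /rowV0Pn[c /sub_kermxP cA c0] : kermx A != 0.
  rewrite kermx_eq0 /row_free; apply/eqP => rA.
  by have := rank_leq_col A; rewrite rA ltnn.
have {cA} dep : \sum_i c 0 i *: (q i *m w) = 0.
  apply/colP => j; have /rowP/(_ j) := cA; rewrite !mxE summxE => cA_j.
  by rewrite -[RHS]cA_j; apply: eq_bigr => i _; rewrite !mxE.
have [i0 ci0] : exists i, c 0 i != 0.
  by apply/existsP; apply: contraNT c0; rewrite negb_exists => /forallP c0;
    apply/eqP/rowP => i; rewrite !mxE; apply/eqP; have := c0 i; rewrite negbK.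
pose l := [arg max_(l > i0 | c 0 l != 0) (l : nat)].
have [cl l_max] : c 0 l != 0 /\ forall i, c 0 i != 0 -> (i <= l)%N.
  by rewrite /l; case: arg_maxnP.
have qE (i : nat) : (i <= l)%N -> q i = (\prod_(a <- take (l - i) (drop i s)) a) * q l.
  by move=> il; rewrite /q -{2}(subnK il) -drop_drop -big_cat cat_take_drop.
have ls : (l <= size s)%N by rewrite sz_s -ltnS.
(* [l] is the last index, that is the shortest product, in the relation. *)
have [a Ja wa] : exists2 a, J a & q l *m w = a *m (q l *m w).
  exists (\sum_(i < n.+2 | (i < l)%N)
            (- (c 0 i / c 0 l)) *: \prod_(x <- take (l - i) (drop i s)) x).
    apply: (big_ind J) => [||i il]; [|exact: JD|].
      case: (s) sz_s Js => [|x t] // _ /(_ x (mem_head _ _)) Jx.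
      by rewrite -(scale0r x); apply: JZ.
    apply/JZ/JP => [|x /mem_take/mem_drop]; last exact: Js.
    rewrite -size_eq0 size_takel ?size_drop ?leq_sub2r //.
    by rewrite subn_eq0 -ltnNge.
  apply: (scalerI cl); rewrite mulmx_suml scaler_sumr.
  move/eqP: dep; rewrite (bigD1 l) //= addr_eq0 => /eqP ->.
  rewrite (bigID (fun i : 'I_n.+2 => (i < l)%N)) /= [X in _ + X]big1 ?addr0.
    rewrite -sumrN; apply: eq_big => [i|i /andP[il il']].
      have [il|] := ltnP i l; rewrite ?andbF // andbT.
      by apply: contraTneq il => ->; rewrite ltnn.
    by rewrite -scalemxAl scalerA mulrN mulrCA divff // mulr1 scaleNr
      (qE i (ltnW il')) -mulmxE -mulmxA.
  move=> i /andP[il]; rewrite -leqNgt => li.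
  have [/eqP ->|/l_max il'] := boolP (c 0 i == 0); first by rewrite scale0r.
  by case/eqP: il; apply/val_inj/eqP; rewrite eqn_leq il' li.
have [k ak] := Jnil a Ja.
have wk i : q l *m w = a ^+ i *m (q l *m w).
  by elim: i => [|i IH]; rewrite ?expr0 ?mul1mx // exprSr -mulmxA -wa.
have {wk} wl : q l *m w = 0 by rewrite (wk k) ak mul0mx.
by rewrite (qE _ (leq0n l)) -mulmxE -mulmxA wl mulmx0.
Qed.

Inductive linear_span (F : fieldType) (V : lmodType F) (S : V -> Prop) : V -> Prop :=
| span_gen a : S a -> linear_span S a
| span_add a b : linear_span S a -> linear_span S b -> linear_span S (a + b)
| span_scale c a : linear_span S a -> linear_span S (c *: a).

(** The identity (u - 1)(v - 1) = (uv - 1) - (u - 1) - (v - 1) makes the span of the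
    [u - 1] an algebra; all its elements have trace zero, hence are nilpotent. *)
Lemma kolchin (F : numFieldType) (n : nat) (U : 'M[F]_n.+1 -> Prop) :
    (forall u v, U u -> U v -> U (u * v)) ->
    (forall u, U u -> exists k, (u - 1) ^+ k = 0) ->
  forall s : seq 'M[F]_n.+1, size s = n.+1 ->
    (forall a, a \in s -> exists2 u, U u & a = u - 1) -> \prod_(a <- s) a = 0.
Proof.
move=> UM Unip s sz_s Us.
pose S (a : 'M[F]_n.+1) := exists2 u, U u & a = u - 1.
have SM a b : S a -> S b -> linear_span S (a * b).
  move=> [u Uu ->] [v Uv ->].
  have -> : (u - 1) * (v - 1) = (u * v - 1) + (-1) *: ((u - 1) + (v - 1)).
    rewrite scaleN1r mulrBr mulr1 mulrBl mul1r [in RHS]opprD [RHS]addrA [RHS]addrAC.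
    by congr (_ - _); rewrite [in RHS]opprB addrA subrK.
  apply: span_add; first by apply: span_gen; exists (u * v); first exact: UM.
  by apply/span_scale/span_add; apply: span_gen; [exists u|exists v].
have JM a b : linear_span S a -> linear_span S b -> linear_span S (a * b).
  move=> Ja Jb; elim: Ja => [x Sx|x y _ IHx _ IHy|c x _ IHx].
  - elim: Jb => [y Sy|y z _ IHy _ IHz|c y _ IHy]; first exact: SM.
      by rewrite mulrDr; apply: span_add.
    by rewrite -scalerAr; apply: span_scale.
  - by rewrite mulrDl; apply: span_add.
  - by rewrite -scalerAl; apply: span_scale.
have Jtr a : linear_span S a -> \tr a = 0.
  elim=> [x [u /Unip[k uk] ->]|x y _ x0 _ y0|c x _ x0].
  - exact: mxtrace_nilpotent uk.
  - by rewrite mxtraceD x0 y0 addr0.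
  - by rewrite mxtraceZ x0 mulr0.
apply: (@nil_algebra_nilpotent _ _ (linear_span S)) => //.
- exact: span_add.
- exact: span_scale.
- move=> a Ja; apply: nilpotent_of_mxtrace => k; apply: Jtr.
  by elim: k => [|k IH]; rewrite ?expr1 // exprS; apply: JM.
- by move=> a /Us Sa; apply: span_gen.
Qed.


(** * Affine maps as matrices in homogeneous coordinates *)

Section AffineMatrix.
Variables (R : fieldType) (V : vectType R).
Local Notation n := (\dim {:V}).
Local Notation e := (vbasis {:V}).
Implicit Types (g h : Aff V) (x : V).

Let eP : basis_of {:V} e := vbasisP {:V}.

Definition affmx g : 'M[R]_n.+1 :=
  block_mx 1%:M 0 (vcoord (aff_trans g))^T (mxof e e (aff_lin g))^T.

Definition hcoord x : 'cV[R]_n.+1 := col_mx 1%:M (vcoord x)^T.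

(** Defined on all matrices, because as a linear left inverse of [affmx] it
    transports linear combinations of powers of [affmx z]. *)
Definition unaffmx (Y : 'M[R]_n.+1) : V * 'End(V) :=
  (vecof e (dlsubmx (Y : 'M_(1 + n)))^T,
   hommx e e (drsubmx (Y : 'M_(1 + n)))^T).

Lemma vcoord_act g x :
  vcoord (aff_act g x) = vcoord x *m mxof e e (aff_lin g) + vcoord (aff_trans g).
Proof. by rewrite /vcoord /aff_act linearD /= (rVof_app _ eP). Qed.

Lemma affmx_act g x : affmx g *m hcoord x = hcoord (aff_act g x).
Proof.
rewrite /affmx /hcoord (@mul_block_col _ 1 n 1 n 1) vcoord_act linearD /= trmx_mul.
by rewrite mul1mx mul0mx addr0 mulmx1 addrC.
Qed.

Lemma affmx1 : affmx 1%g = 1.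
Proof.
rewrite /affmx /vcoord linear0 trmx0 (mxof1 (basis_free eP)) trmx1.
by rewrite -scalar_mx_block.
Qed.

Lemma affmxM g h : affmx (g * h)%g = affmx g * affmx h.
Proof.
rewrite /affmx -mulmxE (@mulmx_block _ 1 n 1 n 1 n).
rewrite !mul1mx !mul0mx !mulmx0 !mulmx1 addr0 add0r.
rewrite -[aff_trans (g * h)%g]/(aff_act g (aff_trans h)) vcoord_act linearD /=.
rewrite -[aff_lin (g * h)%g]/(aff_lin g \o aff_lin h)%VF (mxof_comp _ _ eP).
by rewrite !trmx_mul add0r [X in block_mx _ _ X _]addrC.
Qed.

Lemma affmxK g : unaffmx (affmx g) = aff_val g.
Proof.
rewrite /unaffmx /affmx block_mxKdl block_mxKdr !trmxK.
by rewrite (rVofK eP) (mxofK eP eP); case: g => -[].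
Qed.

Lemma affmx_inj : injective affmx.
Proof.
by move=> g h gh; apply: val_inj; have := congr1 unaffmx gh; rewrite !affmxK.
Qed.

Lemma unaffmx_linear : linear unaffmx.
Proof.
move=> c Y Y'; rewrite /unaffmx.
have -> : (dlsubmx (c *: Y + Y' : 'M_(1 + n)))^T =
    c *: (dlsubmx (Y : 'M_(1 + n)))^T + (dlsubmx (Y' : 'M_(1 + n)))^T.
  by apply/matrixP => i j; rewrite !mxE.
have -> : (drsubmx (c *: Y + Y' : 'M_(1 + n)))^T =
    c *: (drsubmx (Y : 'M_(1 + n)))^T + (drsubmx (Y' : 'M_(1 + n)))^T.
  by apply/matrixP => i j; rewrite !mxE.
by rewrite linearP hommx_linear.
Qed.

HB.instance Definition _ := GRing.isSemilinear.Build R _ _ _ unaffmx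
  (GRing.semilinear_linear unaffmx_linear).

Lemma affmx_row0 g j : affmx g 0 j = (j == 0)%:R.
Proof.
have -> : 0 = @lshift 1 n 0 by apply: val_inj.
case: (@splitP 1 n j) => k jk.
  have -> : j = lshift n k by apply: val_inj.
  by rewrite /affmx (@block_mxEul _ 1 n 1 n) mxE !ord1 eqxx.
have -> : j = rshift 1 k by apply: val_inj.
by rewrite /affmx (@block_mxEur _ 1 n 1 n) mxE.
Qed.

Lemma affmx_surj (Y : 'M[R]_n.+1) :
    Y \is a GRing.unit -> (forall j, Y 0 j = (j == 0)%:R) ->
  exists g, affmx g = Y.
Proof.
move=> Yu Y0.
have YE : Y = block_mx 1%:M 0 (dlsubmx (Y : 'M_(1 + n))) (drsubmx (Y : 'M_(1 + n))).
  have ul : ulsubmx (Y : 'M_(1 + n)) = 1%:M.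
    apply/matrixP => i j; rewrite !mxE !ord1 /= -(Y0 0).
    by congr (Y _ _); apply: val_inj.
  have ur : ursubmx (Y : 'M_(1 + n)) = 0.
    apply/matrixP => i j; rewrite !mxE !ord1 /=.
    rewrite [RHS](_ : 0 = (rshift 1 j == 0)%:R) // -Y0.
    by congr (Y _ _); apply: val_inj.
  by rewrite -[LHS](@submxK _ 1 n 1 n) ul ur.
set D := drsubmx _ in YE.
have Du : D^T \in unitmx.
  move: Yu; rewrite YE -[_ \is a _]/(_ \in unitmx) unitmx_tr !unitmxE.
  by rewrite (@det_lblock _ 1 n) det1 mul1r.
have ker : lker (unaffmx Y).2 == 0%VS.
  apply/lker0P => x y /=; rewrite !hommxE //.
  by move=> /(can_inj (vecofK eP))/(can_inj (mulmxK Du))/(can_inj (rVofK eP)).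
exists (MkAff ker); rewrite /affmx /aff_trans /aff_lin /= /vcoord.
by rewrite (vecofK eP) (hommxK eP eP) !trmxK -YE.
Qed.

End AffineMatrix.

(** * Roots of unipotent elements in Zariski closed groups *)

Section PolynomialFunctions.
Variable R : numFieldType.
Implicit Types (f g : R -> R).

Definition polyfun f : Prop := exists p : {poly R}, forall t, f t = p.[t].

Lemma polyfun_cst c : polyfun (fun=> c).
Proof. by exists c%:P => t; rewrite hornerC. Qed.

Lemma polyfunD f g : polyfun f -> polyfun g -> polyfun (fun t => f t + g t).
Proof. by move=> [p fp] [q gq]; exists (p + q) => t; rewrite hornerD fp gq. Qed.

Lemma polyfunM f g : polyfun f -> polyfun g -> polyfun (fun t => f t * g t).
Proof. by move=> [p fp] [q gq]; exists (p * q) => t; rewrite hornerM fp gq. Qed.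

Lemma polyfun_sum (I : Type) (r : seq I) (f : I -> R -> R) :
  (forall i, polyfun (f i)) -> polyfun (fun t => \sum_(i <- r) f i t).
Proof.
move=> fP; elim: r => [|i r IH].
  by have [p pE] := polyfun_cst 0; exists p => t; rewrite big_nil; apply: pE.
by have [p pE] := polyfunD (fP i) IH; exists p => t; rewrite big_cons pE.
Qed.

Lemma polyfun_prod (I : Type) (r : seq I) (f : I -> R -> R) :
  (forall i, polyfun (f i)) -> polyfun (fun t => \prod_(i <- r) f i t).
Proof.
move=> fP; elim: r => [|i r IH].
  by have [p pE] := polyfun_cst 1; exists p => t; rewrite big_nil; apply: pE.
by have [p pE] := polyfunM (fP i) IH; exists p => t; rewrite big_cons pE.
Qed.

Lemma polyfunX f m : polyfun f -> polyfun (fun t => f t ^+ m).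
Proof. by move=> [p fp]; exists (p ^+ m) => t; rewrite horner_exp fp. Qed.

Lemma polyfun_eq f g : polyfun f -> polyfun g ->
  (forall k : nat, f k%:R = g k%:R) -> f =1 g.
Proof.
move=> [p fp] [q gq] fg t; rewrite fp gq; congr horner.
apply/eqP; rewrite -subr_eq0; apply/eqP.
apply: (@roots_geq_poly_eq0 _ _ [seq k%:R | k <- iota 0 (size (p - q))]).
- by apply/allP => _ /mapP[k _ ->]; rewrite rootE hornerD hornerN -fp -gq fg subrr.
- by rewrite map_inj_uniq ?iota_uniq // => i j /eqP; rewrite eqr_nat => /eqP.
- by rewrite size_map size_iota.
Qed.

Lemma polyfun_meval n (p : mpoly.mpoly n R) (v : R -> 'I_n -> R) :
  (forall i, polyfun (v^~ i)) -> polyfun (fun t => mpoly.meval (v t) p).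
Proof.
move=> vP.
have [q qE] : polyfun (fun t => \sum_(m <- mpoly.msupp p)
    mpoly.mcoeff m p * \prod_i v t i ^+ mpoly.fun_of_multinom m i).
  apply: polyfun_sum => m; apply: polyfunM; first exact: polyfun_cst.
  by apply: polyfun_prod => i; apply: polyfunX.
by exists q => t; rewrite mpoly.mevalE qE.
Qed.

Definition binomial_poly (j : nat) : {poly R} :=
  (j`!%:R^-1)%:P * \prod_(i < j) ('X - i%:R%:P).

Lemma horner_binomial_poly (j m : nat) : (binomial_poly j).[m%:R] = 'C(m, j)%:R.
Proof.
rewrite hornerM hornerC horner_prod.
have -> : \prod_(i < j) ('X - i%:R%:P).[m%:R] = (m ^_ j)%:R :> R.
  elim: j => [|j IH]; first by rewrite big_ord0.
  rewrite big_ord_recr /= IH hornerXsubC ffactnSr natrM.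
  have [jm|mj] := leqP j m; first by rewrite natrB.
  by rewrite ffact_small // !mul0r.
by rewrite -bin_ffact natrM mulrC mulfK // pnatr_eq0 -lt0n fact_gt0.
Qed.

End PolynomialFunctions.

Section UnipotentPowers.
Variables (R : numFieldType) (n : nat).
Implicit Types (X : 'M[R]_n.+1) (Y : R -> 'M[R]_n.+1).

(** The binomial series of [(1 + X) ^ t], truncated where [X ^+ N = 0]. *)
Definition unipotent_power (N : nat) X (t : R) : 'M[R]_n.+1 :=
  \sum_(j < N) (binomial_poly R j).[t] *: X ^+ j.

Lemma unipotent_power_nat N X k :
  X ^+ N = 0 -> unipotent_power N X k%:R = (1 + X) ^+ k.
Proof.
move=> XN; rewrite /unipotent_power exprDn_comm; last exact: commr_sym (commr1 _).
pose F j := X ^+ j *+ 'C(k, j).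
have widen K : (K <= N + k.+1)%N -> (forall j, (K <= j)%N -> F j = 0) ->
    \sum_(j < K) F j = \sum_(j < N + k.+1) F j.
  move=> KN FK; rewrite -!(big_mkord xpredT F).
  rewrite [RHS](big_cat_nat _ KN) //= [X in _ + X](_ : _ = 0) ?addr0 //.
  rewrite big_nat_cond big1 //; by move=> j /andP[/andP[/FK]].
transitivity (\sum_(j < N) F j).
  by apply: eq_bigr => j _; rewrite horner_binomial_poly scaler_nat.
rewrite widen ?leq_addr //; last first.
  by move=> j Nj; rewrite /F -(subnK Nj) exprD XN mulr0 mul0rn.
rewrite -(widen k.+1) ?leq_addl //; last by move=> j kj; rewrite /F bin_small // mulr0n.
by apply: eq_bigr => j _; rewrite expr1n mul1r.
Qed.

Definition mxpolyfun Y : Prop := forall i j, polyfun (fun t => Y t i j).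

Lemma mxpolyfun_unipotent_power N X : mxpolyfun (unipotent_power N X).
Proof.
move=> i j; have [p pE] : polyfun (fun t =>
    \sum_(l < N) (binomial_poly R l).[t] * (X ^+ l) i j).
  apply: polyfun_sum => l; apply: polyfunM; last exact: polyfun_cst.
  by exists (binomial_poly R l).
by exists p => t; rewrite summxE -pE; apply: eq_bigr => l _; rewrite mxE.
Qed.

Lemma mxpolyfunX Y m : mxpolyfun Y -> mxpolyfun (fun t => Y t ^+ m).
Proof.
move=> YP; elim: m => [|m IH] i j.
  have [p pE] := polyfun_cst ((1 : 'M[R]_n.+1) i j).
  by exists p => t; rewrite expr0; apply: pE.
have [p pE] : polyfun (fun t => \sum_l Y t i l * (Y t ^+ m) l j).
  by apply: polyfun_sum => l; apply: polyfunM; [exact: YP|exact: IH].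
by exists p => t; rewrite exprS -mulmxE mxE pE.
Qed.

(** Both sides of [Y t ^+ m = Y (m * t)] are polynomial in [t] and agree for natural
    [t]; now take [t = 1 / m]. *)
Lemma unipotent_root N X m : (0 < m)%N -> X ^+ N = 0 ->
  unipotent_power N X m%:R^-1 ^+ m = 1 + X.
Proof.
move=> m0 XN; have Yp := mxpolyfun_unipotent_power N X.
apply/matrixP => i j.
have scaled : polyfun (fun t => unipotent_power N X (m%:R * t) i j).
  have [p pE] := Yp i j; exists (p \Po (m%:R%:P * 'X)) => t.
  by rewrite pE horner_comp !hornerE.
have := polyfun_eq (mxpolyfunX m Yp i j) scaled.
rewrite /= => -> => [|k]; last first.
  by rewrite -natrM !unipotent_power_nat // -exprM mulnC.
rewrite mulfV ?pnatr_eq0 -?lt0n //.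
by have := unipotent_power_nat 1 XN; rewrite expr1 => ->.
Qed.
End UnipotentPowers.

Section ZariskiClosed.
Variables (R : numFieldType) (V : vectType R) (A : groupClosed (Aff V)).
Hypothesis A_closed : zariski_closed A.
Local Notation n := (\dim {:V}).

Lemma affmxX (z : Aff V) k : affmx (z ^+ k)%g = affmx z ^+ k.
Proof.
elim: k => [|k IH]; first by rewrite expg0 affmx1 expr0.
by rewrite expgS affmxM IH exprS.
Qed.

(** The real powers of [z] satisfy every polynomial equation that its natural powers
    satisfy: those defining [A], and those expressing that the matrix is affine.
    The root commutes with the commutant of [z], being a polynomial in [z]. *)
Lemma closed_unipotent_root (z : Aff V) N m : z \in A -> (0 < m)%N ->
    (affmx z - 1) ^+ N = 0 ->
  exists y, [/\ y \in A, (y ^+ m)%g = z &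
    forall g, (z * g)%g = (g * z)%g -> (y * g)%g = (g * y)%g].
Proof.
move=> zA m0 XN; set X := affmx z - 1 in XN.
have zX : 1 + X = affmx z by rewrite addrC subrK.
pose Y := unipotent_power N X; set t := m%:R^-1 : R.
have Yk k : Y k%:R = affmx (z ^+ k)%g.
  by rewrite /Y unipotent_power_nat // zX affmxX.
have Ym : Y t ^+ m = affmx z by rewrite unipotent_root.
have Yu : Y t \is a GRing.unit.
  rewrite -(unitrX_pos _ m0) Ym; apply/unitrP; exists (affmx z^-1%g).
  by rewrite -!affmxM mulVg mulgV affmx1.
have Yp := mxpolyfun_unipotent_power N X.
have Y0 j : Y t 0 j = (j == 0)%:R.
  apply: (polyfun_eq (Yp 0 j) (polyfun_cst _)) => k.
  by rewrite -/(Y _) Yk affmx_row0.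
have [y yY] := affmx_surj Yu Y0.
exists y; split.
- have [S AS] := A_closed.
  suff : [set` A] y by [].
  rewrite AS /= => p Sp; rewrite -affmxK yY.
  have coordP i : polyfun (fun s => vcoord (unaffmx (Y s)) 0 i).
    have [q qE] : polyfun (fun s => \sum_(j < N)
        (binomial_poly R j).[s] * vcoord (unaffmx (X ^+ j)) 0 i).
      apply: polyfun_sum => j; apply: polyfunM; last exact: polyfun_cst.
      by exists (binomial_poly R j).
    exists q => s; rewrite -qE /vcoord /Y /unipotent_power !linear_sum summxE.
    by apply: eq_bigr => j _; rewrite !linearZ mxE.
  have := polyfun_eq (polyfun_meval p coordP) (polyfun_cst 0).
  apply=> k; rewrite Yk affmxK.
  have : [set` A] (z ^+ k)%g 
    by elim: k => [|k IH]; rewrite /= ?expg0 ?gpred1 // expgS gpredM.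
  by rewrite AS => /(_ p Sp).
- by apply: affmx_inj; rewrite affmxX yY.
move=> g zg; apply: affmx_inj; rewrite !affmxM yY /Y /unipotent_power.
rewrite mulr_suml mulr_sumr; apply: eq_bigr => j _.
rewrite -scalerAl -scalerAr; congr (_ *: _).
apply/esym/commrX; rewrite /GRing.comm mulrBr mulrBl mulr1 mul1r.
by rewrite -!affmxM zg.
Qed.
End ZariskiClosed.

(** * Proper discontinuity and cocompactness in terms of a norm *)

Section Topology.
Variables (R : realType) (V : vectType R).
Local Notation n := (\dim {:V}).
Local Notation e := (vbasis {:V}).
Implicit Types (x : V) (Gamma : groupClosed (Aff V)).

Let eP : basis_of {:V} e := vbasisP {:V}.

Definition vnorm x : R := `|vcoord x|.

Lemma normr_mx_entry m p (u : 'M[R]_(m, p)) i j : `|u i j| <= `|u|.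
Proof.
rewrite [leRHS]mx_normrE.
exact: (le_bigmax _ (fun ij => `|u ij.1 ij.2|) (i, j)).
Qed.

Lemma normr_mulmx_le m p q (u : 'M[R]_(m, p)) (N : 'M[R]_(p, q)) :
  `|u *m N| <= `|u| * (\sum_j \sum_k `|N j k|).
Proof.
rewrite [leLHS]mx_normrE; apply: bigmax_le => [|[i k] _ /=].
  by rewrite mulr_ge0 // sumr_ge0 // => j _; rewrite sumr_ge0.
rewrite mxE; apply: le_trans (ler_norm_sum _ _ _) _.
rewrite mulr_sumr; apply: ler_sum => j _; rewrite normrM.
apply: ler_pM => //; first exact: normr_mx_entry.
by rewrite (bigD1 k) //= lerDl sumr_ge0.
Qed.

Lemma continuous_affine_rV p q (N : 'M[R]_(p, q)) (t : 'rV[R]_q) :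
  continuous (fun u : 'rV[R]_p => u *m N + t).
Proof.
set C := \sum_j \sum_k `|N j k|.
have C0 : 0 <= C by rewrite sumr_ge0 // => j _; rewrite sumr_ge0.
move=> u; apply/(@cvgrPdist_lt _ _ _ (nbhs u) (nbhs_filter u)) => eps eps0.
have d0 : 0 < eps / (C + 1) by rewrite divr_gt0 // ltr_wpDl.
have := nbhsx_ballx u _ d0; apply: filterS => w; rewrite -ball_normE /= => uw.
rewrite opprD addrACA subrr addr0 -mulmxBl; apply: le_lt_trans (normr_mulmx_le _ _) _.
rewrite -/C; apply: (@le_lt_trans _ _ (`|u - w| * (C + 1))).
  by rewrite ler_wpM2l // lerDl.
by rewrite -ltr_pdivlMr //; rewrite ltr_wpDl.
Qed.

Lemma continuous_aff_act (g : Aff V) : continuous (aff_act g : vtop V -> vtop V).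
Proof.
apply: continuous_comp_initial.
rewrite (_ : _ \o _ = (fun u => u *m mxof e e (aff_lin g) + vcoord (aff_trans g))
    \o (@vcoord _ V : vtop V -> 'rV_n)); last first.
  by apply/funext => x /=; rewrite vcoord_act.
move=> x; apply: continuous_comp; first exact: initial_continuous.
exact: continuous_affine_rV.
Qed.

Lemma vnorm_act_le (g : Aff V) : exists C, forall r x,
  vnorm x <= r -> vnorm (aff_act g x) <= r * C + vnorm (aff_trans g).
Proof.
exists (\sum_j \sum_k `|mxof e e (aff_lin g) j k|) => r x xr.
rewrite /vnorm vcoord_act; apply: le_trans (ler_normD _ _) _.
rewrite lerD2r; apply: le_trans (normr_mulmx_le _ _) _.
by rewrite ler_wpM2r // sumr_ge0 // => j _; rewrite sumr_ge0.
Qed.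

Lemma compact_vnorm_ball r : compact ([set x : V | vnorm x <= r] : set (vtop V)).
Proof.
have -> : [set x : V | vnorm x <= r] = vecof e @` [set u | `|u| <= r].
  apply/seteqP; split=> [x xr|_ [u ur <-]] /=.
    by exists (vcoord x) => //; rewrite /vcoord (rVofK eP).
  by rewrite /vnorm /vcoord (vecofK eP).
apply: (@continuous_compact _ (vtop V)).
  apply: continuous_subspaceT; apply: continuous_comp_initial.
  rewrite (_ : _ \o _ = id); first by move=> u.
  by apply/funext => u /=; rewrite /vcoord (vecofK eP).
apply: bounded_closed_compact.
  exists r; split; first exact: num_real.
  by move=> s rs u /= ur; apply: le_trans ur (ltW rs).
rewrite (_ : [set u | _] = Num.norm @^-1` [set s | s <= r]) //.
by apply: closed_comp => [u _|]; [exact: norm_continuous|exact: closed_le].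
Qed.

Lemma compact_vnorm_bounded (K : set (vtop V)) :
  compact K -> exists r, forall x, K x -> vnorm x <= r.
Proof.
move=> cK; have : compact ((@vcoord _ V : vtop V -> 'rV_n) @` K).
  apply: continuous_compact => //; apply: continuous_subspaceT.
  exact: initial_continuous.
move=> /compact_bounded[M [_ MP]]; exists (M + 1) => x Kx.
by apply: (MP (M + 1)); [rewrite ltrDl|exists x].
Qed.

Lemma nbhs_vnorm_ball (x : V) : nbhs (x : vtop V) [set y : V | vnorm y <= vnorm x + 1].
Proof.
have ball_x : nbhs (x : vtop V) ((@vcoord _ V) @^-1` ball (vcoord x) 1).
  exact: (@initial_continuous _ _ (@vcoord _ V) x _ (nbhsx_ballx _ _ ltr01)).
apply: (@filterS _ _ (nbhs_filter (x : vtop V)) _ _ _ ball_x) => y.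
rewrite /= -ball_normE /= /vnorm => xy.
rewrite -[vcoord y](subrK (vcoord x)) addrC.
by apply: le_trans (ler_normD _ _) _; rewrite lerD2l distrC ltW.
Qed.
End Topology.

Section Crystallographic.
Variables (R : realType) (V : vectType R).
Implicit Types (Gamma : groupClosed (Aff V)).

Definition cobounded Gamma : Prop :=
  exists r : R, forall x : V, exists2 g, g \in Gamma & vnorm (aff_act g x) <= r.

Definition returning Gamma (r : R) : set (Aff V) :=
  [set g | g \in Gamma /\ exists x : V, vnorm x <= r /\ vnorm (aff_act g x) <= r].

Lemma properly_discontinuousP Gamma :
  properly_discontinuous Gamma <-> forall r, finite_set (returning Gamma r).
Proof.
split=> [pd r|fin K /compact_vnorm_bounded[r rP]].
  apply: sub_finite_set (pd _ (@compact_vnorm_ball _ V r)) => g [gG [x [xr gxr]]].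
  by split=> //; exists (aff_act g x); split=> //; exists x.
apply: sub_finite_set (fin r) => g [gG [_ [[x Kx <-] Kgx]]].
by split=> //; exists x; split; apply: rP.
Qed.

(** For the direct implication: the images of the balls of integer radius have
    interiors that cover the orbit space, as the saturation of an open set is
    open. *)
Lemma orbit_space_compactP Gamma :
  compact [set: orbit_space Gamma] <-> cobounded Gamma.
Proof.
pose pi : vtop V -> orbit_space Gamma := \pi_(orbit_space Gamma).
have piP (x y : vtop V) : pi x = pi y <-> exists2 g, g \in Gamma & aff_act g x = y.
  by split=> [/eqquotP/asboolP|xy] //; apply/eqquotP/asboolP.
split=> [/compact_near_coveringP cov|[r rP]]; last first.
  have -> : [set: orbit_space Gamma] = pi @` [set x : V | vnorm x <= r].
    apply/seteqP; split=> // q _; have [g gG gr] := rP (repr q).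
    exists (aff_act g (repr q)) => //; rewrite -[RHS]reprK.
    by apply/esym/piP; exists g.
  apply: (@continuous_compact (vtop V) (orbit_space Gamma)).
    by apply: continuous_subspaceT; apply: pi_continuous.
  exact: compact_vnorm_ball.
have near_all (q : orbit_space Gamma) : [set: orbit_space Gamma] q ->
    \forall q' \near q & m \near \oo, exists2 x : V, vnorm x <= m%:R & pi x = q'.
  move=> _; pose x : vtop V := repr q.
  have piS : nbhs q (pi @` [set y : V | vnorm y <= vnorm x + 1]).
    have := nbhs_vnorm_ball x; rewrite nbhsE => -[U [oU Ux] UB].
    rewrite nbhsE; exists (pi @` U).
    2: by move=> _ [y Uy <-]; exists y => //; apply: UB.
    split; last by exists x => //; rewrite /pi reprK.
    rewrite /open /= /quotient_open openE => y [u Uu /esym/piP[g gG gy]].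
    have Ugy : nbhs (aff_act g y : vtop V) U.
      by apply: open_nbhs_nbhs; split=> //; rewrite gy.
    have := @continuous_aff_act _ _ g y _ Ugy.
    apply: (@filterS _ _ (nbhs_filter (y : vtop V))) => z Uz.
    by exists (aff_act g z) => //; apply/esym/piP; exists g.
  exists (pi @` [set y : V | vnorm y <= vnorm x + 1],
          [set m : nat | vnorm x + 1 <= m%:R]).
    by split=> //=; apply: nbhs_infty_ger.
  move=> [q' m] /= [[y yx yq] xm]; exists y => //; exact: le_trans yx xm.
have [m mP] := filter_ex (cov _ _ _ _ near_all).
exists m%:R => x; have [y ym /piP[g gG gy]] := mP (pi x) I.
by exists g^-1%g; rewrite ?gpredV // -gy -aff_actM mulVg aff_act1.
Qed.

Lemma crystallographicP Gamma :
  affine_crystallographic Gamma <->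
  (forall r, finite_set (returning Gamma r)) /\ cobounded Gamma.
Proof. 
by split=> -[/properly_discontinuousP ? /orbit_space_compactP ?]; split=> //.
Qed.

End Crystallographic.

(** * The centralizer of a crystallographic group is unipotent *)

Section CentralizerUnipotent.
Variables (R : realType) (V : vectType R).
Local Notation n := (\dim {:V}).
Local Notation e := (vbasis {:V}).
Let eP : basis_of {:V} e := vbasisP {:V}.

Lemma finite_set_bounded (T : choiceType) (S : set T) (f : T -> R) :
  finite_set S -> exists C, forall s, S s -> f s <= C.
Proof.
move=> /finite_seqP[s ->]; exists (\sum_(x <- s) `|f x|) => x /= xs.
rewrite (perm_big _ (perm_to_rem xs)) big_cons /=.
by apply: le_trans (ler_norm _) _; rewrite lerDl sumr_ge0.
Qed.

Lemma normr_mulmx_col_le m p (N : 'M[R]_(m, p)) (u : 'cV[R]_p) :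
  `|N *m u| <= `|N| * p%:R * `|u|.
Proof.
apply: le_trans (normr_mulmx_le _ _) _; rewrite -mulrA ler_wpM2l //.
have -> : p%:R * `|u| = \sum_(j < p) `|u| by rewrite sumr_const card_ord mulr_natl.
apply: ler_sum => j _; by rewrite big_ord1 normr_mx_entry.
Qed.

Lemma hcoord_surj (u : 'cV[R]_n.+1) : u 0 0 = 1 -> exists x : V, hcoord x = u.
Proof.
move=> u0; exists (vecof e (dsubmx (u : 'cV_(1 + n)))^T).
rewrite /hcoord /vcoord (vecofK eP) trmxK.
have <- : usubmx (u : 'cV_(1 + n)) = 1%:M.
  by apply/matrixP => i j; rewrite !ord1 !mxE /= -u0; congr (u _ _); apply: val_inj.
exact: (@vsubmxK _ 1 n 1 u).
Qed.

Lemma hcoord00 (x : V) : hcoord x 0 0 = 1.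
Proof.
by rewrite (_ : 0 = @lshift 1 n 0) ?(@col_mxEu _ 1 n 1) ?mxE //; apply: val_inj.
Qed.

Lemma vnorm_le_hcoord (x : V) : vnorm x <= `|hcoord x|.
Proof.
rewrite /vnorm [leLHS]mx_normrE; apply: bigmax_le => [//|[i j] _ /=].
rewrite ord1 (_ : vcoord x 0 j = hcoord x (rshift 1 j) 0) ?normr_mx_entry //.
by rewrite /hcoord (@col_mxEd _ 1 n 1) [RHS]mxE.
Qed.

Lemma hcoord_le (x : V) : `|hcoord x| <= 1 + vnorm x.
Proof.
rewrite [leLHS]mx_normrE; apply: bigmax_le => [|[i j] _ /=].
  by rewrite addr_ge0 ?normr_ge0.
rewrite ord1; case: (@splitP 1 n i) => k ik.
  rewrite (_ : i = 0) ?hcoord00 ?normr1 ?lerDl ?normr_ge0 //.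
  by apply: val_inj; rewrite /= ik ord1.
rewrite (_ : i = rshift 1 k); last exact: val_inj.
by rewrite /hcoord (@col_mxEd _ 1 n 1) mxE (le_trans (normr_mx_entry _ _ _)) // lerDr.
Qed.

(** Let [f] be the Fitting idempotent of [affmx z - 1]; it commutes with [Gamma], so
    [1 - f] is an equivariant projection of [V] to an affine subspace. If [f] is not
    zero there is a point [c] of that subspace with a whole line [c + t *: w] above
    it. Some [g] in [Gamma] brings [c + t *: w] to a bounded set, hence returns [c]
    near itself, so [g] ranges over a finite set independent of [t]; then
    [t *: w], which is the image under [g^-1] of a bounded vector, is bounded. *)
Lemma centralizer_crystallographic_unipotent (Gamma : groupClosed (Aff V)) (z : Aff V) :
    affine_crystallographic Gamma ->
    (forall g, g \in Gamma -> (z * g = g * z)%g) ->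
  exists k, (affmx z - 1) ^+ k = 0.
Proof.
move=> /crystallographicP[fin [r rP]] zC; set X := affmx z - 1.
have [p [] ] := fitting_idempotent X; set f := X * horner_mx X p => ff; apply.
have X0 j : X 0 j = 0 by rewrite mxE affmx_row0 !mxE eq_sym subrr.
have f0 j : f 0 j = 0 by rewrite /f -mulmxE mxE big1 // => i _; rewrite X0 mul0r.
have fC g : g \in Gamma -> f * affmx g = affmx g * f.
  move=> gG; have XC : X * affmx g = affmx g * X.
    by rewrite mulrBl mulrBr mulr1 mul1r -!affmxM zC.
  have pC : horner_mx X p * affmx g = affmx g * horner_mx X p.
    exact: (comm_horner_mx p XC).
  by rewrite /f -mulrA pC mulrA XC mulrA.
suff fx x : f *m hcoord x = 0.
  have fn0 i j : j != 0 -> f i j = 0.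
    move=> jn0; have [y yE] : exists y, hcoord y = hcoord 0 + delta_mx j 0.
      by apply: hcoord_surj; rewrite mxE hcoord00 mxE eq_sym (negPf jn0) addr0.
    have := fx y; rewrite yE mulmxDr fx add0r -colE => /colP/(_ i).
    by rewrite [LHS]mxE [RHS]mxE.
  apply/matrixP => i j; rewrite [RHS]mxE.
  have [-> | /fn0 //] := eqVneq j 0.
  have /colP/(_ i) := fx 0.
  rewrite mxE [RHS]mxE (bigD1 0) //= hcoord00 mulr1 big1 ?addr0 //.
  by move=> l /fn0 ->; rewrite mul0r.
apply: contrapT => /eqP w0; set w := f *m hcoord x in w0.
have fw : f *m w = w by rewrite /w mulmxA mulmxE ff.
have w00 : w 0 0 = 0 by rewrite mxE big1 // => i _; rewrite f0 mul0r.
(* [c] is the projection of [x] to the image of [1 - f]. *)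
have [c cE] : exists c, hcoord c = hcoord x - w.
  by apply: hcoord_surj; rewrite mxE hcoord00 mxE w00 subr0.
pose C := (`|1 - f| + `|f|) * n.+1%:R * (1 + r).
have [D DP] := finite_set_bounded (fun g => `|affmx g^-1%g| * n.+1%:R)
  (fin (Num.max (vnorm c) C)).
(* Chosen so that [t * `|w|] exceeds the bound [D * C] found below. *)
pose t := (D * C + 1) / `|w|.
have [y yE] : exists y, hcoord y = hcoord c + t *: w.
  by apply: hcoord_surj; rewrite mxE hcoord00 mxE w00 mulr0 addr0.
have [g gG gyr] := rP y; set k := aff_act g y in gyr.
have kE : hcoord k = affmx g *m (hcoord c + t *: w) by rewrite -yE affmx_act.
have fc : f *m hcoord c = 0 by rewrite cE mulmxBr fw subrr.
have fk : f *m hcoord k = t *: (affmx g *m w).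
  rewrite kE mulmxA mulmxE fC // -mulmxE -mulmxA mulmxDr fc add0r -!scalemxAr.
  by rewrite fw.
have gc : hcoord (aff_act g c) = (1 - f) *m hcoord k.
  by rewrite mulmxBl fk mul1mx kE mulmxDr -scalemxAr addrK affmx_act.
have hk : `|hcoord k| <= 1 + r by rewrite (le_trans (hcoord_le k)) // lerD2l.
have r1 : 0 <= 1 + r by apply: le_trans hk.
have CgE N : `|N| <= `|1 - f| + `|f| -> `|N *m hcoord k| <= C.
  move=> NC; apply: le_trans (normr_mulmx_col_le _ _) _.
  by rewrite /C; apply: ler_pM => //; [rewrite mulr_ge0|rewrite ler_wpM2r].
have gS : returning Gamma (Num.max (vnorm c) C) g.
  split=> //; exists c; split; rewrite le_max ?lexx // orbC.
  rewrite (le_trans (vnorm_le_hcoord _)) // gc CgE // lerDl //.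
have wE : t *: w = affmx g^-1%g *m (f *m hcoord k).
  by rewrite fk -scalemxAr mulmxA mulmxE -affmxM mulVg affmx1 mul1mx.
have D0 : 0 <= D by apply: le_trans (DP _ gS); rewrite mulr_ge0.
have C0 : 0 <= C by rewrite /C mulr_ge0 // mulr_ge0 // addr_ge0.
have : `|t *: w| <= D * C.
  rewrite wE; apply: le_trans (normr_mulmx_col_le _ _) _.
by apply: ler_pM => //; [rewrite mulr_ge0|exact: DP|apply: CgE; rewrite lerDr].
have t0 : 0 <= t by rewrite /t divr_ge0 // addr_ge0 // mulr_ge0.
rewrite normrZ (ger0_norm t0) /t -mulrA mulVf ?mulr1 ?normr_eq0 //.
by rewrite gerDl ler10.
Qed.

End CentralizerUnipotent.

(** * The filtration of a unipotent group *)

Section UnipotentFiltration.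
Variables (K : numFieldType) (B : algType K) (H : groupType) (M : H -> B).
Hypothesis M1 : M 1%g = 1.
Hypothesis MM : forall g h, M (g * h)%g = M g * M h.
Variable Z : groupClosed H.
Implicit Types (g h z : H) (a b w : B).

(** The flag of iterated invariants of [Z] acting on [B] by left multiplication. *)
Fixpoint unip_flag (j : nat) (w : B) : Prop :=
  if j is i.+1 then forall z, z \in Z -> unip_flag i ((M z - 1) * w) else w = 0.

(** The elements that lower the flag by [k] steps: a filtration of the algebra [B],
    invariant under conjugation by the normalizer of [Z], such that [M z - 1] is of
    degree at least [1] for [z] in [Z]. *)
Definition shifts (k : nat) (a : B) : Prop :=
  forall j w, unip_flag (j + k) w -> unip_flag j (a * w).

Definition normalizes g : Prop := forall z, ((z ^ g)%g \in Z) = (z \in Z).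

Lemma unip_flagD j w w' : unip_flag j w -> unip_flag j w' -> unip_flag j (w + w').
Proof.
elim: j w w' => [|j IH] w w' /=; first by move=> -> ->; rewrite addr0.
by move=> Ww Ww' z zZ; rewrite mulrDr; apply: IH; [apply: Ww|apply: Ww'].
Qed.

Lemma unip_flagZ j c w : unip_flag j w -> unip_flag j (c *: w).
Proof.
elim: j w => [|j IH] w /=; first by move=> ->; rewrite scaler0.
by move=> Ww z zZ; rewrite -scalerAr; apply/IH/Ww.
Qed.

Lemma unip_flagS j w : unip_flag j w -> unip_flag j.+1 w.
Proof.
elim: j w => [|j IH] w; first by move=> /= -> z _; rewrite mulr0.
by move=> Ww z zZ; apply: IH; apply: Ww.
Qed.

Lemma unip_flagJ g j w : normalizes g -> unip_flag j w -> unip_flag j (M g * w).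
Proof.
move=> gZ; elim: j w => [|j IH] w /=; first by move=> ->; rewrite mulr0.
move=> Ww z zZ.
have -> : (M z - 1) * (M g * w) = M g * ((M (z ^ g)%g - 1) * w).
  rewrite !mulrA; congr (_ * _).
  by rewrite mulrBl mulrBr -!MM mulr1 mul1r conjgE mulVKg.
by apply/IH/Ww; rewrite gZ.
Qed.

(** The flag exhausts [B] as soon as all products of [N] matrices [M z - 1] vanish. *)
Lemma unip_flag_prod N :
  (forall s : seq B, size s = N ->
     (forall a, a \in s -> exists2 z, z \in Z & a = M z - 1) ->
     \prod_(a <- s) a = 0) -> unip_flag N 1.
Proof.
move=> prod0.
suff: forall w, (forall s : seq B, size s = N ->
    (forall a, a \in s -> exists2 z, z \in Z & a = M z - 1) ->
    \prod_(a <- s) a * w = 0) -> unip_flag N w.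
  by apply=> s sz_s Zs; rewrite mulr1 prod0.
elim: N {prod0} => [|N IH] w w0 /=.
  by have := w0 [::]; rewrite big_nil mul1r; apply.
move=> z zZ; apply: IH => s sz_s Zs.
have := w0 (rcons s (M z - 1)); rewrite -cats1 big_cat big_seq1 -mulrA; apply.
  by rewrite size_cat addn1 sz_s.
by move=> a; rewrite mem_cat inE => /orP[/Zs //|/eqP ->]; exists z.
Qed.

Lemma shiftsD k a b : shifts k a -> shifts k b -> shifts k (a + b).
Proof.
move=> Ia Ib j w Ww; rewrite mulrDl.
by apply: unip_flagD; [apply: Ia|apply: Ib].
Qed.

Lemma shiftsZ k c a : shifts k a -> shifts k (c *: a).
Proof. by move=> Ia j w Ww; rewrite -scalerAl; apply/unip_flagZ/Ia. Qed.

Lemma shiftsN k a : shifts k a -> shifts k (- a).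
Proof. by rewrite -scaleN1r; apply: shiftsZ. Qed.

Lemma shiftsB k a b : shifts k a -> shifts k b -> shifts k (a - b).
Proof. by move=> Ia Ib; apply/shiftsD/shiftsN. Qed.

Lemma shifts0 k : shifts k 0.
Proof.
move=> j w _; rewrite mul0r; elim: j => //= j IH z _; by rewrite mulr0.
Qed.

Lemma shiftsM k l a b : shifts k a -> shifts l b -> shifts (k + l) (a * b).
Proof. by move=> Ia Ib j w; rewrite addnA -mulrA => /Ib/Ia. Qed.

Lemma shiftsW k l a : (k <= l)%N -> shifts l a -> shifts k a.
Proof.
move=> kl Ia j w Ww; apply: Ia.
rewrite -(subnK kl) addnCA addnC; elim: (l - k)%N => [|i IH]; first by rewrite addn0.
by rewrite addnS; apply: unip_flagS.
Qed.

Lemma shiftsJ k g a : normalizes g -> shifts k a -> shifts k (M g * a * M g^-1%g).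
Proof.
move=> gZ Ia j w Ww; rewrite -!mulrA; apply: unip_flagJ => //; apply: Ia.
by apply: unip_flagJ => // z; rewrite -(gZ (z ^ g^-1)%g) conjgKV.
Qed.

Lemma shifts_eq0 N a : unip_flag N 1 -> shifts N a -> a = 0.
Proof. by move=> W1 /(_ 0%N 1 W1) /=; rewrite mulr1. Qed.

Definition in_layer (k : nat) z : Prop := z \in Z /\ shifts k (M z - 1).

Lemma in_layer1 z : z \in Z -> in_layer 1 z.
Proof. by move=> zZ; split=> // j w; rewrite addn1 => /(_ z zZ). Qed.

Lemma subrD_split (a b c d : B) : a - (b + d) = (a - (b + c)) + (c - d).
Proof. by rewrite addrA !opprD !addrA subrK. Qed.

Lemma M_sub1M g h : M (g * h)%g - 1 = (M g - 1) + (M h - 1) + (M g - 1) * (M h - 1).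
Proof.
rewrite MM mulrBl mul1r mulrBr mulr1 [RHS]addrC (addrC (M g - 1)) addrA subrK.
by rewrite addrA subrK.
Qed.

(** On a layer [z |-> M z - 1] is additive modulo the next degree, because
    (g - 1)(h - 1) has twice the degree. *)
Lemma in_layerM_mod k g h : in_layer k.+1 g -> in_layer k.+1 h ->
  shifts k.+2 (M (g * h)%g - 1 - ((M g - 1) + (M h - 1))).
Proof.
move=> [_ Ig] [_ Ih]; rewrite M_sub1M addrAC subrr add0r.
by apply: (@shiftsW _ (k.+1 + k.+1)); [rewrite addnS ltnS leq_addr|apply: shiftsM].
Qed.

Lemma in_layerM k g h : in_layer k g -> in_layer k h -> in_layer k (g * h)%g.
Proof.
move=> [gZ Ig] [hZ Ih]; split; first exact: gpredM.
rewrite M_sub1M; apply: shiftsD; first exact: shiftsD.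
by apply: (@shiftsW _ (k + k)); [exact: leq_addl|apply: shiftsM].
Qed.

Lemma in_layerV k g : in_layer k g -> in_layer k g^-1%g.
Proof.
move=> [gZ Ig]; split; first by rewrite gpredV.
have gVZ : (g^-1)%g \in Z by rewrite gpredV.
have -> : M g^-1%g - 1 = - ((M g - 1) + (M g^-1%g - 1) * (M g - 1)).
  have := M_sub1M g^-1%g g; rewrite mulVg M1 subrr => /esym/eqP.
  by rewrite -addrA addr_eq0 => /eqP.
apply/shiftsN/shiftsD => //.
apply: (@shiftsW _ (1 + k)); first exact: leq_addl.
by apply: shiftsM => //; case: (in_layer1 gVZ).
Qed.

Lemma M_conj_sub1 g z : M (g * z * g^-1)%g - 1 = M g * (M z - 1) * M g^-1%g.
Proof. by rewrite !MM mulrBr mulrBl mulr1 -[M g * M g^-1%g]MM mulgV M1. Qed.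

Lemma in_layerJ k g z : normalizes g -> in_layer k z -> in_layer k (g * z * g^-1)%g.
Proof.
move=> gZ [zZ Iz]; split.
  by rewrite -gZ conjgE -!mulgA mulVg mulg1 mulKg.
by rewrite M_conj_sub1; apply: shiftsJ.
Qed.

Lemma in_layerX k y m : in_layer k.+1 y -> in_layer k.+1 (y ^+ m)%g /\
  shifts k.+2 (M (y ^+ m)%g - 1 - m%:R *: (M y - 1)).
Proof.
move=> yk; elim: m => [|m [IHk IH]].
  rewrite expg0 M1 subrr scale0r subrr; split; last exact: shifts0.
  by split; [exact: gpred1|rewrite M1 subrr; exact: shifts0].
rewrite expgS; split; first exact: in_layerM.
rewrite -nat1r scalerDl scale1r (subrD_split _ _ (M (y ^+ m)%g - 1)).
by apply: shiftsD => //; exact: in_layerM_mod.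
Qed.

(** If [M y - 1] has degree [i] then, modulo degree [i + 1], [M z - 1] is [m] times
    [M y - 1]; as [m] is invertible, the degree of [y] climbs up to that of [z]. *)
Lemma in_layer_root k z y m : (0 < m)%N -> in_layer k.+1 z -> y \in Z ->
  (y ^+ m)%g = z ->
  in_layer k.+1 y /\ shifts k.+2 (m%:R *: (M y - 1) - (M z - 1)).
Proof.
move=> m0 [zZ zk] yZ ymz.
suff yk : in_layer k.+1 y.
  split=> //; rewrite -opprB -ymz; apply: shiftsN.
  by case: (in_layerX m yk).
suff Hi i : (i <= k)%N -> in_layer i.+1 y by exact: Hi.
elim: i => [|i IH] ik; first exact: in_layer1.
have [_] := in_layerX m (IH (ltnW ik)); rewrite ymz => Ii.
split=> //; have -> : M y - 1 = m%:R^-1 *: (M z - 1 - (M z - 1 - m%:R *: (M y - 1))).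
  by rewrite opprB addrCA subrr addr0 scalerA mulVf ?scale1r // pnatr_eq0 -lt0n.
by apply/shiftsZ/shiftsB => //; apply: shiftsW zk.
Qed.

Lemma in_layerV_mod k g : in_layer k.+1 g ->
  shifts k.+2 (M g^-1%g - 1 - - (M g - 1)).
Proof.
move=> gk; have := in_layerM_mod (in_layerV gk) gk.
by rewrite mulVg M1 subrr sub0r => /shiftsN; rewrite !opprK.
Qed.

Hypothesis Z_divisible :
  forall m z, (0 < m)%N -> z \in Z -> exists2 y, y \in Z & (y ^+ m)%g = z.

(** So the image of a layer in its graded piece is closed under sums and division
    by [m]: modulo the next degree, every mean value of elements of the layer is
    attained by an element of the layer. *)
Lemma layer_average k m (zs : seq H) : (0 < m)%N ->
    (forall z, z \in zs -> in_layer k.+1 z) ->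
  exists b : H, in_layer k.+1 b /\
    shifts k.+2 (m%:R *: (M b - 1) - \sum_(z <- zs) (M z - 1)).
Proof.
move=> m0 zsk.
have [p [pk Ip]] : exists p, in_layer k.+1 p /\
    shifts k.+2 (M p - 1 - \sum_(z <- zs) (M z - 1)).
  elim: zs zsk => [|z zs IH] zsk.
    exists 1%g; rewrite big_nil M1 subr0 subrr; split; last exact: shifts0.
    by split; [exact: gpred1|rewrite M1 subrr; exact: shifts0].
  have [|p [pk Ip]] := IH; first by move=> x xs; apply: zsk; rewrite inE xs orbT.
  have zk : in_layer k.+1 z by apply: zsk; rewrite inE eqxx.
  exists (z * p)%g; split; first exact: in_layerM.
  rewrite big_cons.
  rewrite (subrD_split _ _ (M p - 1)).
  by apply: shiftsD => //; apply: in_layerM_mod.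
have [pZ _] := pk.
have [b bZ bmp] := Z_divisible m0 pZ.
have [bk Ib] := in_layer_root m0 pk bZ bmp.
exists b; split=> //.
by have := shiftsD Ib Ip; rewrite addrA subrK.
Qed.

End UnipotentFiltration.

Local Open Scope group_scope.

(** * Lifting the action of an extension *)

Section Centralizer.
Variables (L H : groupType) (A : groupClosed H) (rho : {ghom L -> H}).

Definition centralizer : {pred H} :=
  [pred z | (z \in A) && `[< forall x, z * rho x = rho x * z >]].

Lemma centralizerP z :
  reflect (z \in A /\ forall x, z * rho x = rho x * z) (z \in centralizer).
Proof. by apply: (iffP andP) => -[zA /asboolP]. Qed.

Lemma centralizer_group_closed : group_closed centralizer.
Proof.
split=> [|y z /centralizerP[yA yC] /centralizerP[zA zC]]; apply/centralizerP.
  by split=> [|x]; rewrite ?gpred1 // mul1g mulg1.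
split=> [|x]; first by rewrite gpredM ?gpredV.
have zVC : z^-1 * rho x = rho x * z^-1.
  by apply: (mulgI z); rewrite mulVKg mulgA zC mulgK.
by rewrite -mulgA zVC !mulgA yC.
Qed.

HB.instance Definition _ :=
  isMulClosed.Build H centralizer (group_closedM centralizer_group_closed).
HB.instance Definition _ :=
  isMul1Closed.Build H centralizer (proj1 centralizer_group_closed).
HB.instance Definition _ :=
  isInvClosed.Build H centralizer (group_closedV centralizer_group_closed).

End Centralizer.

Section Lifting.
Variables (Lambda Delta : groupType) (E : extension Lambda Delta).
Variables (H : groupType) (A : groupClosed H) (rho : {ghom Lambda -> H}).
Local Notation Z := (centralizer A rho : groupClosed H).
Local Notation cos := (\pi_(ext_quotient E)).

(** A system of intertwiners that is compatible with [rho] on each coset of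
    [Lambda]; these are the candidates for extending [rho] to [Delta]. *)
Definition lift (a : Delta -> H) : Prop :=
  [/\ forall d, a d \in A,
      forall d x, rho (ext_aut E d x) = a d * rho x * (a d)^-1
    & forall d x, a (d * E x) = a d * rho x].

Definition defect (a : Delta -> H) (c d : Delta) : H :=
  a c * a d * (a (c * d))^-1.

Lemma coset_repr (d : Delta) : exists x, d = repr (cos d) * E x.
Proof.
have /morph_imgP[x Ex] : (repr (cos d))^-1 * d \in morph_img E.
  exact: (@repr_coset _ (ext_normal E)).
by exists x; rewrite Ex mulVKg.
Qed.

Lemma coset_emb d x : cos (d * E x) = cos d.
Proof. by apply/esym/coset_eqP; rewrite mulKg; apply/morph_imgP; exists x. Qed.

(** Choose an intertwiner for one representative of each coset only. *)
Lemma lift_exists : (forall x, rho x \in A) ->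
    (forall d, exists2 g, g \in A &
      forall x, rho (ext_aut E d x) = g * rho x * g^-1) ->
  exists a, lift a.
Proof.
move=> rhoA conjA.
have {}conjA d : exists g, g \in A /\
    forall x, rho (ext_aut E d x) = g * rho x * g^-1.
  by case: (conjA d) => g gA gE; exists g.
have [g gP] := choice conjA; have [y yE] := choice coset_repr.
exists (fun d => g (repr (\pi_(ext_quotient E) d)) * rho (y d)); split.
- by move=> d; case: (gP (repr (cos d))) => gA _; rewrite gpredM.
- move=> d x; rewrite {1}(yE d) ext_autM ext_aut_emb.
  rewrite -[aut_fun _ x]/(ext_aut E (repr (cos d)) (inn (y d) x)) (gP _).2 /=.
  rewrite conjgE invgK.
  by rewrite !gmulfM gmulfV invgM !mulgA.
move=> d x; rewrite coset_emb -mulgA -gmulfM; congr (_ * rho _).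
apply: (@ext_inj _ _ E); rewrite gmulfM; apply: (mulgI (repr (cos d))).
by rewrite mulgA -yE -(coset_emb d x) -yE.
Qed.

Variable a : Delta -> H.
Hypothesis a_lift : lift a.

Lemma lift_in d : a d \in A. Proof. by case: a_lift. Qed.
Lemma lift_conj d x : rho (ext_aut E d x) = a d * rho x * (a d)^-1.
Proof. by case: a_lift. Qed.
Lemma lift_emb d x : a (d * E x) = a d * rho x.
Proof. by case: a_lift. Qed.

Lemma lift_rho d x : a d * rho x = rho (ext_aut E d x) * a d.
Proof. by rewrite lift_conj mulgVK. Qed.

Lemma ext_autVK d x : ext_aut E d (ext_aut E d^-1 x) = x.
Proof.
by apply: (@ext_inj _ _ E); rewrite !ext_autE invgK !mulgA mulgV mul1g mulgK.
Qed.

Lemma rho_lift d x : rho x * a d = a d * rho (ext_aut E d^-1 x).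
Proof. by rewrite lift_rho ext_autVK. Qed.

Lemma lift_normalizes d : normalizes Z (a d).
Proof.
move=> z; apply/centralizerP/centralizerP => -[zA zC].
  have zE : z = a d * z ^ a d * (a d)^-1 by rewrite conjgE mulVKg mulgK.
  split=> [|x].
    by rewrite zE; apply: gpredM; [apply: gpredM|rewrite gpredV]; rewrite ?lift_in.
  have za : z * a d = a d * z ^ a d by rewrite conjgE mulVKg.
  apply: (mulIg (a d)); rewrite -!mulgA rho_lift za mulgA za -mulgA zC mulgA.
  by rewrite -rho_lift -mulgA.
split=> [|x]; first by rewrite conjgE !gpredM ?gpredV ?lift_in.
apply: (mulgI (a d)); rewrite conjgE -!mulgA mulVKg lift_rho !mulgA zC lift_rho.
by rewrite mulgK.
Qed.

Lemma defect_centralizes c d : defect a c d \in Z.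
Proof.
apply/centralizerP; split; first by rewrite !gpredM ?gpredV ?lift_in.
move=> x; rewrite /defect; apply: (mulIg (a (c * d))).
rewrite -!mulgA mulVg mulg1 rho_lift mulKg lift_rho (mulgA (a c)) lift_rho.
by rewrite -[ext_aut E c _]/((ext_aut E c * ext_aut E d) _) -ext_autM ext_autVK mulgA.
Qed.

(** By this and the next lemma, [defect a] is a function on [Delta / Lambda] in both
    arguments. *)
Lemma defect_emb_r c d x : defect a c (d * E x) = defect a c d.
Proof. by rewrite /defect mulgA !lift_emb invgM !mulgA mulgK. Qed.

Lemma defect_emb_l c d x : defect a (c * E x) d = defect a c d.
Proof.
have Ex : c * E x * d = c * d * E (ext_aut E d^-1 x).
  by rewrite ext_autE invgK !mulgA mulgK.
by rewrite /defect Ex !lift_emb -(mulgA _ _ (a d)) rho_lift invgM !mulgA mulgK.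
Qed.

Lemma defect_cocycle c d e :
  defect a c d * defect a (c * d) e =
  a c * defect a d e * (a c)^-1 * defect a c (d * e).
Proof. by rewrite /defect !mulgA !mulgVK. Qed.
End Lifting.

(** * Vanishing of the obstruction *)

Section Splitting.
Variables (K : numFieldType) (B : algType K) (H : groupType) (M : H -> B).
Hypothesis M1 : M 1%g = 1%R.
Hypothesis MM : forall g h, M (g * h)%g = (M g * M h)%R.
Hypothesis M_inj : injective M.
Variables (Lambda Delta : groupType) (E : extension Lambda Delta).
Variables (A : groupClosed H) (rho : {ghom Lambda -> H}).
Local Notation Z := (centralizer A rho : groupClosed H).
Local Notation cos := (\pi_(ext_quotient E)).
Hypothesis Z_divisible :
  forall m z, (0 < m)%N -> z \in Z -> exists2 y, y \in Z & (y ^+ m)%g = z.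
Variable qs : seq (ext_quotient E).
Hypothesis qs_uniq : uniq qs.
Hypothesis mem_qs : forall q, q \in qs.

(** The classical proof that a finite group has no second cohomology in a vector
    space, carried out modulo the next layer: summing the cocycle identity over the
    last argument shows that the cocycle is the coboundary of its mean [b], so
    dividing [a] by [b] pushes the defect into the next layer. *)
Lemma lift_improve k a : lift E A rho a ->
    (forall c d, in_layer M Z k.+1 (defect a c d)) ->
  exists2 a', lift E A rho a' & forall c d, in_layer M Z k.+2 (defect a' c d).
Proof.
move=> a_lift a_k.
pose m := size qs.
have m0 : (0 < m)%N by rewrite /m lt0n size_eq0; case: qs (mem_qs (cos 1)).
pose eqm u v := shifts M Z k.+2 (u - v)%R.
pose dl g : B := (M g - 1)%R.
pose row c := [seq defect a c (repr q) | q <- qs].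
pose S c : B := (\sum_(q <- qs) dl (defect a c (repr q)))%R.
have row_k c z : z \in row c -> in_layer M Z k.+1 z by case/mapP => q _ ->.
(* The choice depends on the list of values only, so that [b] below is constant on
   cosets of [Lambda]. *)
pose avg (zs : seq H) := xget 1%g [set z | in_layer M Z k.+1 z /\
  shifts M Z k.+2 (m%:R *: (M z - 1) - \sum_(x <- zs) (M x - 1))%R]%classic.
pose b c := avg (row c).
have bP c : in_layer M Z k.+1 (b c) /\ eqm (m%:R *: dl (b c))%R (S c).
  have [z [zk Iz]] := layer_average M1 MM Z_divisible m0 (@row_k c).
  rewrite /b /avg; case: xgetP => [_ -> []|/(_ z) /=]; last by case.
  by rewrite big_map.
have b_emb c x : b (c * E x) = b c.
  by rewrite /b /row; congr avg; apply: eq_map => q; rewrite (defect_emb_l a_lift).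
have bZ c : b c \in Z by case: (bP c) => -[].
pose a' c := (b c)^-1 * a c.
have a'_lift : lift E A rho a'.
  split=> [d|d x|d x].
  - have /centralizerP[bA _] := bZ d.
    by rewrite gpredM ?gpredV // (lift_in a_lift).
  - have /centralizerP[_ bC] := bZ d.
    rewrite /a' invgM invgK -!mulgA (mulgA (rho x)) (mulgA (a d)) (mulgA (a d)).
    rewrite -(lift_conj a_lift).
    by rewrite -bC mulKg.
  - by rewrite /a' b_emb (lift_emb a_lift) mulgA.
exists a' => // c d.
have eqmD u u' v v' : eqm u u' -> eqm v v' -> eqm (u + v)%R (u' + v')%R.
  by move=> Iu Iv; rewrite /eqm opprD addrACA; apply: shiftsD.
have eqmN u u' : eqm u u' -> eqm (- u)%R (- u')%R.
  by move=> Iu; rewrite /eqm -opprD; apply: shiftsN.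
have eqm_trans u v w : eqm u v -> eqm v w -> eqm u w.
  by move=> Iuv Ivw; have := shiftsD Iuv Ivw; rewrite addrA subrK.
have eqm_sym u v : eqm u v -> eqm v u.
  by move=> Iuv; rewrite /eqm -opprB; apply: shiftsN.
have eqm_refl u : eqm u u by rewrite /eqm subrr; apply: shifts0.
have eqmZ t u u' : eqm u u' -> eqm (t *: u)%R (t *: u')%R.
  by move=> Iu; rewrite /eqm -scalerBr; apply: shiftsZ.
have eqmJ e u u' : eqm u u' ->
    eqm (M (a e) * u * M (a e)^-1)%R (M (a e) * u' * M (a e)^-1)%R.
  move=> Iu; rewrite /eqm -mulrBl -mulrBr.
  by apply: shiftsJ => //; apply: (lift_normalizes a_lift).
have eqm_mul g h : in_layer M Z k.+1 g -> in_layer M Z k.+1 h ->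
    eqm (dl (g * h)) (dl g + dl h)%R.
  exact: in_layerM_mod.
pose J u : B := (M (a c) * u * M (a c)^-1)%R.
have JE z : dl (a c * z * (a c)^-1) = J (dl z) by apply: M_conj_sub1.
have reindex : (\sum_(q <- qs) dl (defect a c (d * repr q)%g))%R = S c.
  have dq q : defect a c (d * repr q) = defect a c (repr (cos d * q)).
    have [x dE] := coset_repr E (d * repr q).
    rewrite {1}dE (defect_emb_r a_lift); congr (defect a c (repr _)).
    by rewrite (@Defs.pi_mul _ (ext_normal E)) reprK.
  under eq_bigr do rewrite dq.
  rewrite -(big_map (fun q => cos d * q) xpredT
    (fun q => dl (defect a c (repr q)))).
  apply: perm_big; apply: uniq_perm => //.
    by rewrite map_inj_uniq //; apply: mulgI.
  move=> q; rewrite mem_qs; apply/mapP; exists ((cos d)^-1 * q) => //.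
  by rewrite mulVKg.
have cocycle : eqm (m%:R *: dl (defect a c d) + S (c * d)%g)%R (J (S d) + S c)%R.
  have -> : (m%:R *: dl (defect a c d) + S (c * d)%g =
      \sum_(q <- qs) (dl (defect a c d) + dl (defect a (c * d)%g (repr q))))%R.
    by rewrite big_split /= big_const_seq count_predT iter_addr addr0 scaler_nat.
  have -> : (J (S d) + S c =
      \sum_(q <- qs) (J (dl (defect a d (repr q))) +
                      dl (defect a c (d * repr q)%g)))%R.
    by rewrite big_split /= reindex /J mulr_sumr mulr_suml.
  apply: (big_ind2 eqm) => [//|u u' v v'|q _]; first exact: eqmD.
  have cn := lift_normalizes a_lift c.
  apply: (eqm_trans _ (dl (defect a c d * defect a (c * d)%g (repr q)))).
    by apply/eqm_sym/eqm_mul.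
  rewrite (defect_cocycle a) -JE; apply: eqm_mul => //.
  exact: in_layerJ.
have a'E : defect a' c d =
    (b c)^-1 * (a c * (b d)^-1 * (a c)^-1) * defect a c d * b (c * d).
  by rewrite /defect /a' !invgM !invgK !mulgA !mulgVK.
have bcV := in_layerV M1 MM (bP c).1.
have bdVJ := in_layerJ M1 MM (lift_normalizes a_lift c) (in_layerV M1 MM (bP d).1).
have fcd := a_k c d; have bcd := (bP (c * d)).1.
have a'_lin : eqm (dl (defect a' c d))
    (- dl (b c) + - J (dl (b d)) + dl (defect a c d) + dl (b (c * d)%g))%R.
  rewrite a'E; apply: (eqm_trans _ _ _ (eqm_mul _ _ _ bcd)).
    by apply: (in_layerM MM) => //; apply: (in_layerM MM).
  apply: (eqmD _ _ _ _ _ (eqm_refl _)).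
  apply: (eqm_trans _ _ _ (eqm_mul _ _ _ fcd)); first exact: (in_layerM MM).
  apply: (eqmD _ _ _ _ _ (eqm_refl _)).
  apply: (eqm_trans _ _ _ (eqm_mul _ _ bcV bdVJ)).
  apply: eqmD; first exact: in_layerV_mod (bP c).1.
  rewrite JE; apply: (eqm_trans _ _ _ (eqmJ _ _ _ (in_layerV_mod M1 MM (bP d).1))).
  by rewrite /J mulrN mulNr; apply: (eqm_refl).
split; first exact: (defect_centralizes a'_lift).
rewrite -[(_ - _)%R]/(dl _) -[dl _](scalerK (a := m%:R)) ?pnatr_eq0 -?lt0n //.
apply: shiftsZ.
suff : eqm (m%:R *: dl (defect a' c d))%R 0%R by rewrite /eqm subr0.
apply: (eqm_trans _ _ _ (eqmZ _ _ _ a'_lin)); rewrite 3!scalerDr 2!scalerN.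
have Jb : eqm (m%:R *: J (dl (b d)))%R (J (S d)).
  by rewrite /J scalerAl scalerAr; apply: eqmJ; case: (bP d).
have f_lin : eqm (m%:R *: dl (defect a c d))%R (J (S d) + S c - S (c * d)%g)%R.
  by have := eqmD _ _ _ _ cocycle (eqm_refl (- S (c * d)%g)%R); rewrite addrK.
have sum_bJb := eqmD _ _ _ _ (eqmN _ _ (bP c).2) (eqmN _ _ Jb).
have := eqmD _ _ _ _ (eqmD _ _ _ _ sum_bJb f_lin) (bP (c * d)).2.
congr eqm.
by rewrite addrA subrK -opprD [(J _ + _)%R]addrC addNr.
Qed.

Lemma lift_morphism N : unip_flag M Z N 1%R -> (forall x, rho x \in A) ->
    (forall d, exists2 g, g \in A &
      forall x, rho (ext_aut E d x) = g * rho x * g^-1) ->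
  exists2 a, lift E A rho a & forall c d, a (c * d) = a c * a d.
Proof.
move=> W1 rhoA conjA.
have step k : exists2 a, lift E A rho a &
    forall c d, in_layer M Z k.+1 (defect a c d).
  elim: k => [|k [a a_lift a_k]]; last exact: lift_improve a_lift a_k.
  have [a a_lift] := lift_exists rhoA conjA.
  by exists a => // c d; apply/in_layer1/(defect_centralizes a_lift).
have [a a_lift aN] := step N; exists a => // c d.
have [_ /(shiftsW (leqnSn N))/(shifts_eq0 W1)/eqP] := aN c d.
rewrite subr_eq0 -M1 => /eqP/M_inj; rewrite /defect => /(canRL (mulgVK _)).
by rewrite mul1g.
Qed.

End Splitting.

Local Close Scope group_scope.

(** * Finite index and crystallographic groups *)

Section Commensurable.
Variables (R : realType) (V : vectType R).

Lemma vnorm_act_bounded (s : seq (Aff V)) (r : R) :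
  exists C, forall h x, h \in s -> vnorm x <= r -> vnorm (aff_act h x) <= C.
Proof.
elim: s => [|g s [C CP]]; first by exists 0.
have [D DP] := vnorm_act_le g.
exists (Num.max (r * D + vnorm (aff_trans g)) C) => h x.
rewrite inE le_max => /predU1P[-> xr|hs xr]; first by rewrite DP.
by rewrite (CP h x hs xr) orbT.
Qed.

Variables (Gamma Gamma' : groupClosed (Aff V)) (s : seq (Aff V)).
Hypothesis sub : {subset Gamma <= Gamma'}.
Hypothesis cosets : forall g, g \in Gamma' ->
  exists2 h, h \in s & (h^-1 * g)%g \in Gamma.

Lemma crystallographic_subgroup :
  affine_crystallographic Gamma' -> affine_crystallographic Gamma.
Proof.
move=> /crystallographicP[fin [r rP]]; apply/crystallographicP; split=> [t|].
  by apply: sub_finite_set (fin t) => g [/sub gG' xP].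
have [C CP] := vnorm_act_bounded [seq h^-1%g | h <- s] r.
exists C => x; have [g gG' gx] := rP x; have [h hs hg] := cosets gG'.
by exists (h^-1 * g)%g; rewrite // aff_actM CP // map_f.
Qed.

Lemma crystallographic_overgroup :
  affine_crystallographic Gamma -> affine_crystallographic Gamma'.
Proof.
move=> /crystallographicP[fin [r rP]]; apply/crystallographicP.
split=> [t|]; last first.
  by exists r => x; have [g /sub gG' gx] := rP x; exists g.
have [C CP] := vnorm_act_bounded [seq h^-1%g | h <- s] t.
apply: sub_finite_set (finite_image2 (fun g h => (g * h^-1)%g)
  (fin (Num.max C t)) (finite_seq s)).
move=> g [gG' [x [xt gxt]]].
have [h hs hg] : exists2 h, h \in s & (h^-1 * g^-1)%g \in Gamma.
  by apply: cosets; rewrite gpredV.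
exists (g * h)%g; last by exists h => //; rewrite mulgK.
split; first by rewrite -gpredV invgM.
exists (aff_act h^-1%g x); split; first by rewrite le_max CP // map_f.
by rewrite -aff_actM mulgK le_max gxt orbT.
Qed.

End Commensurable.

Section ExtensionFiniteIndex.
Variables (Lambda Delta : groupType) (E : extension Lambda Delta).
Hypothesis E_fin : finite_index (morph_img E).

Lemma finite_coset_reps :
  exists s : seq Delta, forall d, exists2 h, h \in s & exists x, d = (h * E x)%g.
Proof.
have /finite_seqP[ss ssE] := E_fin.
exists [seq xget 1%g c | c : set Delta <- ss] => d.
pose c := [set (d * y)%g | y in [set` morph_img E]].
have css : c \in ss.
  suff : [set` ss] c by [].
  by rewrite -ssE; exists d.
exists (xget 1%g c); first exact: map_f.
case: xgetP => [h -> [y /morph_imgP[x <-] <-]|/(_ d)[]].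
  by exists x^-1%g; rewrite gmulfV mulgK.
by exists 1%g; rewrite ?mulg1 //= gpred1.
Qed.

Lemma finite_quotient_enum :
  exists2 qs : seq (ext_quotient E), uniq qs & forall q, q \in qs.
Proof.
have [s sP] := finite_coset_reps.
exists (undup [seq \pi_(ext_quotient E) h | h <- s]); first exact: undup_uniq.
elim/quotW=> d; rewrite mem_undup; have [h hs [x ->]] := sP d.
by rewrite coset_emb map_f.
Qed.

End ExtensionFiniteIndex.

Section MorphismOf.
Variables (G H : groupType) (f : G -> H).
Hypothesis fM : {morph f : x y / (x * y)%g}.

Lemma morphism1 : f 1%g = 1%g.
Proof. by apply: (mulgI (f 1%g)); rewrite -fM !mulg1. Qed.

(** A name for [f] that carries its morphism structure. *)
Definition morphism_of & {morph f : x y / (x * y)%g} := f.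

HB.instance Definition _ :=
  isUMagmaMorphism.Build G H (morphism_of fM) (conj morphism1 fM).

End MorphismOf.

(** * Fixed points and realizations *)

Section Realization.
Variables (R : realType) (V : vectType R) (A : groupClosed (Aff V)).
Variables (Lambda Delta : groupType) (E : extension Lambda Delta).

Lemma restriction_fixed_point : finite_index (morph_img E) ->
    isom_crystallographic_of_type A Delta ->
  exists c : Dc A Lambda, forall q : ext_quotient E, Dc_act (ext_kernel q) c = c.
Proof.
move=> Efin [Gamma [cG GA [f [fG f_inj fS]]]].
pose rho : {ghom Lambda -> Aff V} := f \o E.
have f_injective : injective f by move=> x y; apply: f_inj; rewrite inE.
have rho_inj : injective rho by apply: inj_comp => //; apply: ext_inj.
have rhoG : {subset morph_img rho <= Gamma}.
  by move=> _ /morph_imgP[x <-]; apply: (fG (E x)).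
have [s sP] := finite_coset_reps Efin.
have rho_cryst : affine_crystallographic (morph_img rho).
  apply: (crystallographic_subgroup (Gamma' := Gamma) (s := map f s)) => // g gG.
  have [d _ <-] := fS g gG; have [h hs [x ->]] := sP d.
  exists (f h); first exact: map_f.
  by apply/morph_imgP; exists x; rewrite gmulfM mulKg.
have rhoA : {subset morph_img rho <= A} by move=> g /rhoG/GA.
exists (\pi_(Dc A Lambda) (MkHomc rho_inj rho_cryst rhoA)).
elim/quotW=> d; rewrite ext_kernel_pi Dc_act_pi.
apply/eqquotP/asboolP; exists (f d); first by apply/GA/(fG d).
move=> x; rewrite -[LHS]/(f (E x)) -[homc_fun _ _]/(f (E (ext_conj E d x))).
by rewrite ext_conjE -gmulfM -gmulfV -gmulfM conjgE mulgA mulgA mulgV mul1g mulgK.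
Qed.

Lemma centralizer_unip_flag (rho : {ghom Lambda -> Aff V}) :
    affine_crystallographic (morph_img rho) ->
  unip_flag (@affmx R V) (centralizer A rho) (\dim {:V}).+1 1%R.
Proof.
move=> cr; apply: unip_flag_prod => s sz_s sP.
apply: (@kolchin _ _ (fun u => exists2 z, z \in centralizer A rho & u = affmx z)) => //.
- move=> _ _ [y yZ ->] [z zZ ->]; exists (y * z)%g; last by rewrite affmxM.
  exact: (@gpredM _ (centralizer A rho : groupClosed _)).
- move=> _ [z /centralizerP[_ zC] ->].
  apply: centralizer_crystallographic_unipotent cr _ => _ /morph_imgP[x <-].
  exact: zC.
- by move=> a /sP[z zZ ->]; exists (affmx z) => //; exists z.
Qed.

Lemma fixed_point_realization : zariski_closed A -> finite_effective_extension E ->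
    (exists c : Dc A Lambda, forall q : ext_quotient E, Dc_act (ext_kernel q) c = c) ->
  isom_crystallographic_of_type A Delta.
Proof.
move=> A_closed [Efin Eeff] [c c_fix].
pose rho : Homc A Lambda := repr c.
have rhoA x : rho x \in A by apply: homc_sub; apply/morph_imgP; exists x.
have conjA d : exists2 g, g \in A &
    forall x, rho (ext_aut E d x) = (g * rho x * g^-1)%g.
  have := c_fix (\pi_(ext_quotient E) d).
  rewrite -[c in LHS]reprK ext_kernel_pi Dc_act_pi -[RHS]reprK.
  move=> /eqquotP/asboolP[g gA gE]; exists g => // x; rewrite gE.
  by congr (_ * rho _ * _)%g; apply: (aut_funK (ext_aut E d)).
have cr := homc_cryst rho.
have Z_div m (z : Aff V) : (0 < m)%N -> z \in centralizer A rho ->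
    exists2 y, y \in centralizer A rho & (y ^+ m)%g = z.
  move=> m0 /centralizerP[zA zC].
  have [k zk] : exists k, (affmx z - 1) ^+ k = 0%R.
    apply: centralizer_crystallographic_unipotent cr _ => _ /morph_imgP[x <-].
    exact: zC.
  have [y [yA ym yC]] := closed_unipotent_root A_closed zA m0 zk.
  by exists y => //; apply/centralizerP; split=> // x; apply: yC.
have [qs qs_uniq mem_qs] := finite_quotient_enum Efin.
have [a [aA aC aE] aM] := lift_morphism (@affmx1 R V) (@affmxM R V) (@affmx_inj R V)
  Z_div qs_uniq mem_qs (centralizer_unip_flag cr) rhoA conjA.
pose f : {ghom Delta -> Aff V} := morphism_of aM.
have fE x : f (E x) = rho x.
  have := aE 1%g x; rewrite mul1g => aEx.
  by rewrite -[LHS]/(a (E x)) aEx -[a 1%g]/(f 1%g) gmulf1 mul1g.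
have f_inj : injective f.
  move=> d d' fdd'; suff dd' : (d^-1 * d')%g = 1%g.
    by rewrite -[d']mul1g -(mulgV d) -mulgA dd' mulg1.
  set k := (d^-1 * d')%g; have fk : f k = 1%g by rewrite gmulfM gmulfV fdd' mulVg.
  have aut_k : ext_aut E k = 1%g.
    apply: autP => x; apply: (@homc_inj _ _ _ _ rho).
    by rewrite aC -[a k]/(f k) fk mul1g invg1 mulg1.
  have /Eeff/esym/coset_eqP : ext_kernel (\pi_(ext_quotient E) k) =
      ext_kernel (\pi_(ext_quotient E) 1%g).
    rewrite !ext_kernel_pi aut_k; congr (\pi_(Out Lambda) _).
    have <- : E 1%g = 1%g by rewrite gmulf1.
    by rewrite ext_aut_emb inn1.
  rewrite invg1 mul1g => /morph_imgP[x xk].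
  rewrite -xk; have -> : x = 1%g.
    by apply: (@homc_inj _ _ _ _ rho); rewrite -fE xk fk gmulf1.
  by rewrite gmulf1.
have [s sP] := finite_coset_reps Efin.
pose Gamma : groupClosed (Aff V) := morph_img f.
exists Gamma; split.
- apply: (crystallographic_overgroup (Gamma := morph_img rho) (s := map f s)) => //.
    by move=> _ /morph_imgP[x <-]; rewrite -fE; apply/morph_imgP; exists (E x).
  move=> _ /morph_imgP[d <-]; have [h hs [x ->]] := sP d.
  exists (f h); first exact: map_f.
  by apply/morph_imgP; exists x; rewrite gmulfM mulKg fE.
- by move=> _ /morph_imgP[d <-]; apply: aA.
exists f; split; first by move=> d _; apply/morph_imgP; exists d.
  by move=> x y _ _; apply: f_inj.
by move=> _ /morph_imgP[d <-]; exists d.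
Qed.

End Realization.

Theorem theorem3p4 (R : realType) (V : vectType R) (A : groupClosed (Aff V))
    (hAclosed : zariski_closed A) (hAtrans : aff_transitive A)
    (Lambda Delta : groupType)
    (hnil : virtually_nilpotent Lambda)
    (hLambda : isom_crystallographic_of_type A Lambda)
    (E : extension Lambda Delta) (hE : finite_effective_extension E) :
  isom_crystallographic_of_type A Delta <->
  exists c : Dc A Lambda,
    forall q : ext_quotient E, Dc_act (ext_kernel q) c = c.
Proof.
split; last exact: fixed_point_realization.
by case: hE => Efin _; apply: restriction_fixed_point.
Qed.
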